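(* Let $B=\{x\in\mathbb{E}^2:\|x\|\le 1\}$ and $0\le\lambda\le 1$. Then $$\gamma_\lambda(B)=\gamma^*_\lambda(B)=\begin{cases}\dfrac{2}{\sqrt3}, & \text{if } 0\le\lambda\le\frac{\sqrt3}{2},\\[2mm] \dfrac{\sqrt{2-2\sqrt{1-\lambda^2}}}{\lambda}, & \text{if }\frac{\sqrt3}{2}\le\lambda\le\frac{2\sqrt2}{3},\\[2mm] \dfrac{3\sqrt3\,\lambda}{4}, & \text{if }\frac{2\sqrt2}{3}\le\lambda\le1.\end{cases}$$ Furthermore, in these three cases respectively, the tightness of a $\lambda$-separable packing $\mathcal F$ of unit disks is $\gamma_\lambda(B)$ if and only if the Delaunay triangles defined by $\mathcal F$ tile $\mathbb{E}^2$ and are all congruent to $T^e_{reg}(1)$, to $T^e\big(\sqrt{2-2\sqrt{1-\lambda^2}}\big)$, and to $T^e\big(\sqrt{\tfrac32}\,\lambda\big)$.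
   Context: $\mathbb{E}^2$ is the Euclidean plane. A packing of disks is a family of disks with pairwise disjoint interiors. For $0\le\lambda\le\rho$, a packing $\mathcal P$ of disks of radius $\rho>0$ is called $\lambda$-separable if the family $\mathcal P'$ of disks of radius $\lambda$ concentric to the disks of $\mathcal P$ is totally separable, i.e. any two disks of $\mathcal P'$ can be separated by a line which is disjoint from the interior of every disk of $\mathcal P'$. (Two disks are separated by a line if they lie in different closed half planes bounded by it.) Unit disks have radius $\rho=1$. $\gamma_\lambda(B)$ (resp. $\gamma^*_\lambda(B)$) is the smallest $r>0$ such that there is a $\lambda$-separable unit disk packing $B+X$ (resp. a $\lambda$-separable lattice packing $B+\Lambda$ of unit disks, $\Lambda$ a $2$-dimensional lattice) with $\mathbb{E}^2=rB+X$ (resp. $\mathbb{E}^2=rB+\Lambda$). The tightness of a packing $\mathcal P=B+X$ of unit disks is the smallest $r>0$ with $\mathbb{E}^2=rB+X$. $T^e_{reg}(1)$ is the regular triangle of edge length $2$. For $0<\lambda<y$, put $x^e(y)=\frac{y^2}{2\sqrt{y^2-\lambda^2}}$; $T^e(y)$ is the isosceles triangle with edge lengths $2y,\,2x^e(y),\,2x^e(y)$. The Delaunay triangles defined by a packing are the triangular cells of the Delaunay decomposition defined by the set $X$ of centers: the locally finite edge-to-edge tiling of $\operatorname{conv}(X)$ by convex polygons with vertices in $X$ such that the circumdisk of each tile contains no point of $X$ in its interior and only the vertices of the tile on its boundary. *)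

(* Defs.v *)
From HB Require Import structures.
From mathcomp Require Import all_boot all_order all_algebra.
From mathcomp Require Import all_classical all_reals all_analysis.

Set Implicit Arguments.
Unset Strict Implicit.
Unset Printing Implicit Defensive.

Import Order.TTheory GRing.Theory Num.Theory.
Import numFieldNormedType.Exports.

Local Open Scope classical_set_scope.
Local Open Scope ring_scope.

(* The library norm `|_| on 'rV[R]_2 is the sup norm, hence a separate Euclidean
   norm.  Both induce the same topology, so `interior A` below is the Euclidean interior. *)
Definition dotp (R : realType) (u v : 'rV[R]_2) : R := \sum_i u 0 i * v 0 i.

Definition enorm (R : realType) (u : 'rV[R]_2) : R := Num.sqrt (dotp u u).

Definition edist (R : realType) (u v : 'rV[R]_2) : R := enorm (u - v).

Definition disk (R : realType) (c : 'rV[R]_2) (r : R) : set 'rV[R]_2 :=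
  [set p | edist p c <= r].

Definition circle (R : realType) (c : 'rV[R]_2) (r : R) : set 'rV[R]_2 :=
  [set p | edist p c = r].

(* A line is given by a normal vector u, which must be required to be nonzero,
   and a level c. *)
Definition line (R : realType) (u : 'rV[R]_2) (c : R) : set 'rV[R]_2 :=
  [set p | dotp u p = c].

Definition halfplane (R : realType) (u : 'rV[R]_2) (c : R) : set 'rV[R]_2 :=
  [set p | dotp u p <= c].

Definition cohalfplane (R : realType) (u : 'rV[R]_2) (c : R) : set 'rV[R]_2 :=
  [set p | c <= dotp u p].

(* X is the set of centers. *)
Definition packing (R : realType) (rho : R) (X : set 'rV[R]_2) : Prop :=
  forall x y, X x -> X y -> x <> y ->
    interior (disk x rho) `&` interior (disk y rho) = set0.

(* For lam = 0 the disks are points, their interiors are empty, and the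
   separating lines may pass through them. *)
Definition totally_separable (R : realType) (lam : R) (X : set 'rV[R]_2) : Prop :=
  forall x y, X x -> X y -> x <> y ->
    exists (u : 'rV[R]_2) (c : R),
      [/\ u <> 0,
          disk x lam `<=` halfplane u c,
          disk y lam `<=` cohalfplane u c &
          forall z, X z -> line u c `&` interior (disk z lam) = set0].

Definition separable_packing (R : realType) (rho lam : R) (X : set 'rV[R]_2)
  : Prop := packing rho X /\ totally_separable lam X.

Definition lattice (R : realType) (L : set 'rV[R]_2) : Prop :=
  exists a b : 'rV[R]_2,
    free [:: a; b] /\
    L = [set a *~ ij.1 + b *~ ij.2 | ij in [set: int * int]].

(* E^2 = r B + X, as a Minkowski sum. *)
Definition covering (R : realType) (r : R) (X : set 'rV[R]_2) : Prop :=
  [set b + x | b in disk 0 r & x in X] = [set: 'rV[R]_2].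

Definition is_min (R : realType) (S : set R) (r : R) : Prop :=
  S r /\ lbound S r.

Definition tightness (R : realType) (X : set 'rV[R]_2) (g : R) : Prop :=
  is_min [set r | 0 < r /\ covering r X] g.

Definition gamma (R : realType) (lam g : R) : Prop :=
  is_min [set r | 0 < r /\
            exists X, separable_packing 1 lam X /\ covering r X] g.

Definition gamma_lattice (R : realType) (lam g : R) : Prop :=
  is_min [set r | 0 < r /\
            exists L, [/\ lattice L, separable_packing 1 lam L & covering r L]] g.

Definition convex_hull (R : realType) (A : set 'rV[R]_2) : set 'rV[R]_2 :=
  smallest (@convex_set R 'rV[R]_2) A.

Definition convex_polygon (R : realType) (T : set 'rV[R]_2) : Prop :=
  exists V, [/\ finite_set V, T = convex_hull V & interior T !=set0].

Definition face (R : realType) (T F : set 'rV[R]_2) : Prop :=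
  exists (u : 'rV[R]_2) (c : R),
    [/\ u <> 0, T `<=` halfplane u c & F = T `&` line u c].

Definition vertices (R : realType) (T : set 'rV[R]_2) : set 'rV[R]_2 :=
  [set v | face T [set v]].

Definition edges (R : realType) (T : set 'rV[R]_2) : set (set 'rV[R]_2) :=
  [set e | face T e /\ exists a b, a <> b /\ e = convex_hull [set a; b]].

Definition tiling (R : realType) (A : set 'rV[R]_2) (D : set (set 'rV[R]_2))
  : Prop :=
  [/\ forall T, D T -> convex_polygon T,
      \bigcup_(T in D) T = A &
      forall T T', D T -> D T' -> T <> T' -> interior T `&` interior T' = set0].

Definition locally_finite (R : realType) (D : set (set 'rV[R]_2)) : Prop :=
  forall (p : 'rV[R]_2) (r : R), finite_set [set T | D T /\ T `&` disk p r !=set0].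

Definition edge_to_edge (R : realType) (D : set (set 'rV[R]_2)) : Prop :=
  forall T T', D T -> D T' -> T <> T' ->
    [\/ T `&` T' = set0,
        (exists v, [/\ vertices T v, vertices T' v & T `&` T' = [set v]]) |
        (exists e, [/\ edges T e, edges T' e & T `&` T' = e])].

(* D is the Delaunay decomposition defined by X; such a D need not exist for an
   arbitrary X. *)
Definition delaunay_decomposition (R : realType) (X : set 'rV[R]_2)
    (D : set (set 'rV[R]_2)) : Prop :=
  [/\ tiling (convex_hull X) D,
      locally_finite D,
      edge_to_edge D &
      forall T, D T ->
        vertices T `<=` X /\
        exists (c : 'rV[R]_2) (r : R),
          [/\ vertices T `<=` circle c r,
              X `&` interior (disk c r) = set0 &
              X `&` circle c r `<=` vertices T]].

Definition triangle (R : realType) (T : set 'rV[R]_2) : Prop :=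
  convex_polygon T /\ exists a b c, T = convex_hull [set a; b; c].

Definition triangular_cells (R : realType) (D : set (set 'rV[R]_2))
  : set (set 'rV[R]_2) := [set T | D T /\ triangle T].

Definition congruent (R : realType) (T T' : set 'rV[R]_2) : Prop :=
  exists f : 'rV[R]_2 -> 'rV[R]_2,
    (forall p q, edist (f p) (f q) = edist p q) /\ f @` T = T'.

(* A triangle specified by its edge lengths is only determined up to isometry, so
   it is rendered as the class of all such triangles. *)
Definition triangle_with_edges (R : realType) (l1 l2 l3 : R)
  : set (set 'rV[R]_2) :=
  [set T | triangle T /\ exists a b c,
     [/\ T = convex_hull [set a; b; c],
         edist a b = l1, edist b c = l2 & edist c a = l3]].

Definition Te_reg (R : realType) : set (set 'rV[R]_2) :=
  triangle_with_edges 2 2 2.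

Definition xe (R : realType) (lam y : R) : R :=
  y ^+ 2 / (2 * Num.sqrt (y ^+ 2 - lam ^+ 2)).

Definition Te (R : realType) (lam y : R) : set (set 'rV[R]_2) :=
  triangle_with_edges (2 * y) (2 * xe lam y) (2 * xe lam y).

Definition delaunay_triangles_tile_congruently (R : realType)
    (X : set 'rV[R]_2) (K : set (set 'rV[R]_2)) : Prop :=
  exists D, [/\ delaunay_decomposition X D,
    tiling [set: 'rV[R]_2] (triangular_cells D) &
    forall T, triangular_cells D T -> exists T0, K T0 /\ congruent T T0].

(* Main.v *)
(* A lower bound for the covering radius comes from Delaunay triangles.  Around
   any point p, maximizing dist(o, X)^2 - |o - p|^2 over o (and then |o - p|^2)
   yields a circle centred at o that is empty, has at least three points of X on
   it, and whose points on the circle have p in their hull.  Total separability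
   forces two altitudes of an acute Delaunay triangle to be at least 2 lam, and
   for such a triangle with sides at least 2 an elementary inequality bounds the
   circumradius from below by the stated value, with equality only for the stated
   triangle.  If the covering radius is this value, then all these circles have
   the same radius and carry exactly three points, since four points would give
   four pairwise obtuse directions; because the radii are equal, two such
   triangles are separated by the radical axis of their circles, so that they
   form the Delaunay decomposition.  Equality is attained by the lattice
   generated by the legs of the extremal triangle. *)

Require Import Defs.
From HB Require Import structures.
From mathcomp Require Import all_boot all_order all_algebra.
From mathcomp Require Import all_classical all_reals all_analysis.
From mathcomp Require Import ring lra.

Set Implicit Arguments.
Unset Strict Implicit.
Unset Printing Implicit Defensive.

Import Order.TTheory GRing.Theory Num.Theory.
Import numFieldNormedType.Exports.
(* [edist] is also the name of a constant of MathComp-Analysis. *)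
Import Defs.

Local Open Scope classical_set_scope.
Local Open Scope ring_scope.

(** * Euclidean plane *)

(** Maximizing dist(o, X)^2 - |o - p|^2 is a linear programme: for [o = p + w] and value [t], each
    point of [X] imposes a constraint affine in [(w, t)]. The first maximum puts an active point in
    every closed half plane bounded by a line through [p]; the second picks an extreme point of the
    optimal face, so that no line through [p] contains all active points. The constants come from
    isosceles triangles with squared leg [Q], squared base [t Q] and squared circumradius [s]. There
    [Q = s (4 - t)], and leg altitudes of at least [2 lam] mean
    [16 lam^2 <= t Q (4 - t) = s t (4 - t)^2]. On [0 < t < 2] the right side is largest at
    [t = 4/3], whence [s = 27/16 lam^2] and [Q = 9/2 lam^2]; then [Q >= 4] means [lam^2 >= 8/9].
    Below that, [Q = 4] binds and [t = 2 - 2 d] with [d^2 = 1 - lam^2]; the base is at least 2 as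
    long as [d <= 1/2], that is, [lam^2 >= 3/4]. Below that, the regular triangle takes over. All
    three values of [s] are below 2, the squared radius at which a circle can first carry four
    points at mutual distance at least 2. *)

Definition sqdist (R : realType) (u v : 'rV[R]_2) : R := dotp (u - v) (u - v).

Definition vec2 (R : realType) (x y : R) : 'rV[R]_2 :=
  \row_j (if j == 0 then x else y).

Definition perp (R : realType) (u : 'rV[R]_2) : 'rV[R]_2 :=
  vec2 (- u 0 1) (u 0 0).

Section Plane.
Variable R : realType.
Implicit Types (a b c o p q u v w : 'rV[R]_2) (r s t k : R).

Lemma dotpE u v : dotp u v = u 0 0 * v 0 0 + u 0 1 * v 0 1.
Proof.
rewrite /dotp big_ord_recl big_ord_recl big_ord0 addr0.
by congr (_ + u _ _ * v _ _); apply/val_inj.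
Qed.

Lemma vec2_0 (x y : R) : vec2 x y 0 0 = x. Proof. by rewrite mxE. Qed.
Lemma vec2_1 (x y : R) : vec2 x y 0 1 = y. Proof. by rewrite mxE. Qed.

Lemma rV2P u v : u 0 0 = v 0 0 -> u 0 1 = v 0 1 -> u = v.
Proof.
move=> h0 h1; apply/rowP => -[[|[|//]] i].
  by rewrite (_ : Ordinal i = 0) //; apply/val_inj.
by rewrite (_ : Ordinal i = 1) //; apply/val_inj.
Qed.

Definition coordE := (dotpE, vec2_0, vec2_1, mxE).

Lemma sqdistE u v :
  sqdist u v = (u 0 0 - v 0 0) ^+ 2 + (u 0 1 - v 0 1) ^+ 2.
Proof. by rewrite /sqdist !coordE. Qed.

Lemma sqdistC u v : sqdist u v = sqdist v u.
Proof. by rewrite !sqdistE; ring. Qed.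

Lemma sqdist_ge0 u v : 0 <= sqdist u v.
Proof. by rewrite sqdistE addr_ge0 ?sqr_ge0. Qed.

Lemma dotp_ge0 u : 0 <= dotp u u.
Proof. by rewrite dotpE addr_ge0 // -expr2 sqr_ge0. Qed.

Lemma dotp_eq0 u : (dotp u u == 0) = (u == 0).
Proof.
apply/idP/eqP => [|->]; last by rewrite dotpE !mxE mul0r addr0.
rewrite dotpE -!expr2 paddr_eq0 ?sqr_ge0 // !sqrf_eq0 => /andP[/eqP h0 /eqP h1].
by apply: rV2P; rewrite mxE.
Qed.

Lemma dotp_gt0 u : u <> 0 -> 0 < dotp u u.
Proof. by move=> /eqP u0; rewrite lt_def dotp_eq0 u0 dotp_ge0. Qed.

Lemma sqdist_eq0 u v : (sqdist u v == 0) = (u == v).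
Proof. by rewrite /sqdist dotp_eq0 subr_eq0. Qed.

Lemma sqdist_gt0 u v : u <> v -> 0 < sqdist u v.
Proof. by move=> /eqP uv; rewrite lt_def sqdist_eq0 uv sqdist_ge0. Qed.

Lemma edistE u v : edist u v = Num.sqrt (sqdist u v). Proof. by []. Qed.

Lemma edist_ge0 u v : 0 <= edist u v. Proof. exact: sqrtr_ge0. Qed.

Lemma sqr_edist u v : edist u v ^+ 2 = sqdist u v.
Proof. by rewrite edistE sqr_sqrtr // sqdist_ge0. Qed.

Lemma edist_le u v r : 0 <= r -> (edist u v <= r) = (sqdist u v <= r ^+ 2).
Proof. by move=> r0; rewrite -sqr_edist ler_sqr // nnegrE edist_ge0. Qed.

Lemma edist_lt u v r : 0 <= r -> (edist u v < r) = (sqdist u v < r ^+ 2).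
Proof. by move=> r0; rewrite -sqr_edist ltr_sqr // nnegrE edist_ge0. Qed.

Lemma edist_ge u v r : 0 <= r -> (r <= edist u v) = (r ^+ 2 <= sqdist u v).
Proof. by move=> r0; rewrite -sqr_edist ler_sqr // nnegrE edist_ge0. Qed.

Lemma edist_eq u v r : 0 <= r -> (edist u v == r) = (sqdist u v == r ^+ 2).
Proof. by move=> r0; rewrite -sqr_edist eqrXn2 // edist_ge0. Qed.

Lemma edistC u v : edist u v = edist v u.
Proof. by rewrite !edistE sqdistC. Qed.

(** Parallelogram law: the defect is [|u + v - 2 w|^2]. It replaces the triangle inequality and
    stays polynomial. *)
Lemma sqdist_le2 u v w : sqdist u v <= 2 * sqdist u w + 2 * sqdist w v.
Proof.
rewrite -subr_ge0 !sqdistE (_ : _ - _ = (u 0 0 + v 0 0 - 2 * w 0 0) ^+ 2 +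
  (u 0 1 + v 0 1 - 2 * w 0 1) ^+ 2); first by rewrite addr_ge0 ?sqr_ge0.
by ring.
Qed.

Lemma dotp_perp u : dotp (perp u) u = 0.
Proof. by rewrite !coordE; ring. Qed.

Lemma perp_eq0 u : perp u = 0 -> u = 0.
Proof.
move=> h; apply/eqP; rewrite -dotp_eq0; move/eqP: h.
by rewrite -dotp_eq0 !dotpE !vec2_0 !vec2_1 mulrNN addrC.
Qed.

Lemma cauchy_schwarz u v : dotp u v ^+ 2 <= dotp u u * dotp v v.
Proof.
rewrite -subr_ge0 (_ : _ - _ = (u 0 0 * v 0 1 - u 0 1 * v 0 0) ^+ 2).
  exact: sqr_ge0.
by rewrite !dotpE; ring.
Qed.

(** All that is used of an interior point: it can be moved a little, in either sense, along any
    vector. *)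
Lemma near_line (A : set 'rV[R]_2) p w : nbhs p A ->
  exists2 e, 0 < e & forall t, `|t| <= e -> A (p + t *: w).
Proof.
move=> pA.
have cf : {for (0 : R), continuous (fun t : R => p + t *: w)}.
  by move=> t; apply: cvgD; [exact: cvg_cst|apply: cvgZr_tmp; exact: cvg_id].
have : nbhs (0 : R) [set t | A (p + t *: w)].
  by apply: cf; rewrite scale0r addr0.
move=> /nbhs_ballP[e /= e0 eA]; exists (e / 2); first by rewrite divr_gt0.
move=> t te; apply: eA; rewrite -ball_normE /= sub0r normrN.
by rewrite (le_lt_trans te) // ltr_pdivrMr // ltr_pMr // ltr1n.
Qed.

Lemma continuous_addr (T : topologicalType) (f g : T -> R) :
  continuous f -> continuous g -> continuous (fun x => f x + g x).
Proof. by move=> cf cg x; exact: (cvgD (cf x) (cg x)). Qed.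

Lemma continuous_mulr (T : topologicalType) (f g : T -> R) :
  continuous f -> continuous g -> continuous (fun x => f x * g x).
Proof. by move=> cf cg x; exact: (cvgM (cf x) (cg x)). Qed.

Lemma continuous_coord (i : 'I_1) (j : 'I_2) :
  continuous (fun p : 'rV[R]_2 => p i j).
Proof. exact: coord_continuous. Qed.

Lemma continuous_sqdist c : continuous (fun p => sqdist p c).
Proof.
rewrite (_ : (fun p => _) = (fun p => (p 0 0 - c 0 0) * (p 0 0 - c 0 0) +
  (p 0 1 - c 0 1) * (p 0 1 - c 0 1))); last first.
  by apply/funext => p; rewrite sqdistE.
by apply: continuous_addr; apply: continuous_mulr; apply: continuous_addr;
  by [exact: continuous_coord|exact: cst_continuous].
Qed.

Lemma continuous_dotp u : continuous (fun p => dotp u p).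
Proof.
rewrite (_ : (fun p => _) = (fun p => u 0 0 * p 0 0 + u 0 1 * p 0 1)); last first.
  by apply/funext => p; rewrite dotpE.
by apply: continuous_addr; apply: continuous_mulr;
  by [exact: continuous_coord|exact: cst_continuous].
Qed.

(** An interior point can be pushed away from the centre without leaving the disk, so its distance
    is not the maximal one. At the centre itself any direction serves. *)
Lemma interior_disk c r : interior (disk c r) = [set p | edist p c < r].
Proof.
apply/seteqP; split=> p /=.
- move=> ip.
  have r0 : 0 <= r by rewrite (le_trans _ (interior_subset ip)) // edist_ge0.
  have [pc|/eqP pc] := eqVneq p c.
    have [e e0 /(_ e)] := near_line (vec2 1 0) ip.
    rewrite gtr0_norm // lexx => /(_ isT); rewrite /disk /= edist_le // edist_lt // pc.
    by rewrite !sqdistE !coordE; nra.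
  have [e e0 /(_ e)] := near_line (p - c) ip.
  rewrite gtr0_norm // lexx => /(_ isT); rewrite /disk /= edist_le // edist_lt //.
  have := sqdist_gt0 pc.
  rewrite !sqdistE !coordE => d0 h; apply: lt_le_trans h.
  rewrite (_ : (p 0 0 + e * (p 0 0 - c 0 0) - c 0 0) ^+ 2 +
    (p 0 1 + e * (p 0 1 - c 0 1) - c 0 1) ^+ 2 =
    (1 + e) ^+ 2 * ((p 0 0 - c 0 0) ^+ 2 + (p 0 1 - c 0 1) ^+ 2)); last by ring.
  by rewrite ltr_pMl // expr2; nra.
- move=> pr; have r0 : 0 < r by rewrite (le_lt_trans _ pr) // edist_ge0.
  rewrite (edist_lt _ _ (ltW r0)) in pr.
  have : open [set q | sqdist q c < r ^+ 2].
    rewrite (_ : [set q | _] = (fun q => sqdist q c) @^-1` [set x | x < r ^+ 2]) //.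
    by apply: open_comp; [move=> ? _; exact: continuous_sqdist|exact: open_lt].
  rewrite openE => /(_ _ pr); apply: interiorS => q /=.
  by rewrite /disk /= (edist_le _ _ (ltW r0)) => /ltW.
Qed.

Lemma packing_sqdist (X : set 'rV[R]_2) :
  packing 1 X <-> forall x y, X x -> X y -> x <> y -> 4 <= sqdist x y.
Proof.
split=> h x y Xx Xy xy; have := h x y Xx Xy xy; rewrite !interior_disk.
- move=> h0; rewrite leNgt; apply/negP => d4.
  (* The midpoint lies in both open disks. *)
  suff : (set0 : set 'rV[R]_2) (2^-1 *: (x + y)) by [].
  rewrite -h0; split; rewrite /= edist_lt // !sqdistE !coordE;
    by rewrite !sqdistE in d4; nra.
- move=> d4; apply/seteqP; split=> // z [] /=; rewrite !edist_lt // !expr1n => zx zy.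
  by have := sqdist_le2 x y z; rewrite (sqdistC x z); lra.
Qed.

Lemma coveringP r (X : set 'rV[R]_2) : covering r X <->
  forall p, exists2 x, X x & edist p x <= r.
Proof.
split=> [h p|h].
  have [b br [x Xx bx]] : [set b + x | b in disk 0 r & x in X] p by rewrite h.
  exists x => //; rewrite -bx; move: br; rewrite /disk /=.
  by rewrite /edist addrK subr0.
apply/seteqP; split=> // p _; have [x Xx px] := h p.
exists (p - x); first by rewrite /disk /= /edist subr0.
by exists x => //; rewrite subrK.
Qed.

End Plane.

(** * Empty circles *)

Section Holes.
Variable R : realType.
Implicit Types (a b c o p q u v w : 'rV[R]_2) (r s t k : R).

Lemma sqr_le_itv (x r : R) : 0 <= r -> x ^+ 2 <= r ^+ 2 -> - r <= x <= r.
Proof.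
by move=> r0 h; rewrite -ler_norml -ler_sqr ?nnegrE // real_normK // num_real.
Qed.

(** Pigeonhole on the unit grid: two points in one cell have squared distance below 2, so [f], which
    records the cell, is injective on the disk. The shift by [r] makes the truncated numbers
    nonnegative. *)
Lemma finite_disk (X : set 'rV[R]_2) p r :
  (forall x y, X x -> X y -> x <> y -> 4 <= sqdist x y) ->
  finite_set (X `&` disk p r).
Proof.
move=> X4; have [r0|r0] := ltP r 0.
  rewrite (_ : _ `&` _ = set0); first exact: finite_set0.
  apply/seteqP; split=> // x [_].
  by rewrite /disk /= leNgt (lt_le_trans r0) // edist_ge0.
pose f (x : 'rV[R]_2) := (Num.trunc (x 0 0 - p 0 0 + r), Num.trunc (x 0 1 - p 0 1 + r)).
have box (x : 'rV[R]_2) : (X `&` disk p r) x ->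
    [/\ 0 <= x 0 0 - p 0 0 + r, x 0 0 - p 0 0 + r <= 2 * r,
        0 <= x 0 1 - p 0 1 + r & x 0 1 - p 0 1 + r <= 2 * r].
  move=> [_]; rewrite /disk /= edist_le // sqdistE => h.
  have /(sqr_le_itv r0)/andP[] : (x 0 0 - p 0 0) ^+ 2 <= r ^+ 2.
    by rewrite (le_trans _ h) // lerDl sqr_ge0.
  have /(sqr_le_itv r0)/andP[] : (x 0 1 - p 0 1) ^+ 2 <= r ^+ 2.
    by rewrite (le_trans _ h) // lerDr sqr_ge0.
  by split; lra.
have finj : {in (X `&` disk p r) &, injective f}.
  move=> x y /set_mem Xx /set_mem Xy [f0 f1].
  apply/eqP; apply: contraT => /eqP xy.
  have := X4 x y Xx.1 Xy.1 xy; rewrite sqdistE.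
  have [x0 _ x1 _] := box x Xx; have [y0 _ y1 _] := box y Xy.
  have := truncn_itv x0; have := truncn_itv y0.
  have := truncn_itv x1; have := truncn_itv y1.
  rewrite f0 f1 -!natr1 => /andP[? ?] /andP[? ?] /andP[? ?] /andP[? ?].
  by nra.
rewrite -(eq_finite_set (inj_card_eq finj)).
apply: (@sub_finite_set _ _ (`I_(Num.trunc (2 * r)).+1 `*` `I_(Num.trunc (2 * r)).+1)).
  move=> _ [x /box [x0 x0' x1 x1']] <-; split=> /=; rewrite ltnS; exact: le_truncn.
by apply: finite_setX; exact: finite_II.
Qed.

Lemma eventually_finite (T : eqType) (s : seq T) (P : T -> R -> Prop) :
  (forall x, x \in s -> exists2 e, 0 < e & forall t, 0 < t <= e -> P x t) ->
  exists2 e, 0 < e & forall x, x \in s -> forall t, 0 < t <= e -> P x t.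
Proof.
elim: s => [|x s IH] h; first by exists 1.
have [y ys|e e0 he] := IH; first by apply: h; rewrite inE ys orbT.
have [e' e'0 he'] := h x (mem_head _ _).
exists (Num.min e e'); first by rewrite lt_min e0.
move=> y; rewrite inE => /predU1P[->|ys] t /andP[t0]; rewrite le_min => /andP[te te'].
  by apply: he'; rewrite t0.
by apply: he => //; rewrite t0.
Qed.

(* The point [p + w] and the number [t + |w|^2] are the centre and the squared
   radius of a circle with no point of [X] inside. *)
Definition feasible (X : set 'rV[R]_2) p w t : Prop :=
  0 <= t /\ forall x, X x -> t <= sqdist x p - 2 * dotp w (x - p).

Lemma feasible_sqdist (X : set 'rV[R]_2) p w t :
  feasible X p w t <->
  0 <= t /\ forall x, X x -> t + dotp w w <= sqdist x (p + w).
Proof.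
have E x : sqdist x (p + w) = sqdist x p - 2 * dotp w (x - p) + dotp w w.
  by rewrite !sqdistE !coordE; ring.
by split=> -[t0 h]; split=> // x /h; rewrite E lerD2r.
Qed.

Lemma feasible_bounded (X : set 'rV[R]_2) p w t r : covering r X ->
  feasible X p w t -> t + dotp w w <= r ^+ 2.
Proof.
move=> /coveringP cX /feasible_sqdist[t0 h]; have [x Xx pw] := cX (p + w).
have r0 : 0 <= r by rewrite (le_trans _ pw) // edist_ge0.
by move: pw; rewrite edist_le // sqdistC; apply: le_trans; exact: h.
Qed.

(** Moving [w] along [v] relaxes a constraint with [dotp v (x - p) < 0] linearly in [e]. A gain
    quadratic in [e] is therefore affordable with [k] fixed beforehand; [k = 1] and [k = 0] serve
    the two maximizations. *)
Lemma feasible_perturb (X : set 'rV[R]_2) p w t v k : 0 <= k ->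
  (forall x y, X x -> X y -> x <> y -> 4 <= sqdist x y) ->
  feasible X p w t ->
  (forall x, X x -> t = sqdist x p - 2 * dotp w (x - p) ->
     k = 0 /\ dotp v (x - p) = 0 \/ dotp v (x - p) < 0) ->
  exists2 e, 0 < e & feasible X p (w + e *: v) (t + k * e ^+ 2).
Proof.
move=> k0 X4 [t0 fe] act.
have dv := dotp_ge0 v; have dw := dotp_ge0 w.
(* Beyond distance [M + 1] from [p] a completed square gives the constraint for every [e <= 1]; only
   the finitely many closer points restrict the step. *)
pose M := 2 * (t + k + 4 * dotp w w + 4 * dotp v v).
have M0 : 0 <= M by rewrite /M; lra.
have /finite_seqP[l El] := finite_disk p (M + 1) X4.
have [x xl|e e0 he] := @eventually_finite _ l (fun x e =>
    t + k * e ^+ 2 <= sqdist x p - 2 * dotp (w + e *: v) (x - p)).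
  have : [set` l] x by [].
  rewrite -El => -[Xx _].
  have Dw e : dotp (w + e *: v) (x - p) = dotp w (x - p) + e * dotp v (x - p).
    by rewrite !coordE; ring.
  set c := dotp v (x - p) in Dw *.
  have := fe x Xx; rewrite le_eqVlt => /predU1P[/[dup] tE /(act x Xx)|tl].
    rewrite -/c => -[[-> c0]|c0].
      by exists 1 => // e _; rewrite Dw c0 tE; lra.
    (* The requirement is [k e^2 <= - 2 e c]; [k + 1] avoids division by zero. *)
    exists (- 2 * c / (k + 1)) => [|e /andP[e0]].
      by rewrite divr_gt0 //; lra.
    by rewrite ler_pdivlMr ?Dw => [h|]; nra.
  (* For an inactive constraint the slack [A] absorbs a change of at most [e (k + 2 |c|)]. *)
  pose A := sqdist x p - 2 * dotp w (x - p) - t.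
  have c1 : c <= `|c| := ler_norm c; have c2 := normr_ge0 c.
  exists (Num.min 1 (A / (k + 2 * `|c| + 1))) => [|e /andP[e0]].
    by rewrite lt_min ltr01 divr_gt0 // /A; lra.
  rewrite le_min => /andP[e1]; rewrite ler_pdivlMr ?Dw => [h|]; last by lra.
  suff : k * e ^+ 2 + 2 * e * c <= A by rewrite /A; lra.
  apply: le_trans h.
  have h1 : k * e ^+ 2 <= k * e by rewrite ler_wpM2l // expr2; nra.
  by nra.
exists (Num.min 1 e); first by rewrite lt_min ltr01.
have m0 : 0 < Num.min 1 e <= e by rewrite lt_min ltr01 e0 ge_min lexx orbT.
have m1 : Num.min 1 e <= 1 by rewrite ge_min lexx.
set m := Num.min 1 e in m0 m1 *; move/andP: (m0) => [mp _].
split; first by nra.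
move=> x Xx; have [xl|xM] := leP (edist x p) (M + 1).
  have xl' : x \in l by have : [set` l] x by rewrite -El.
  exact: he.
have : (M + 1) ^+ 2 <= sqdist x p by rewrite -edist_ge ?ltW //; lra.
have CS : 0 <= dotp (x - p - 2 *: (w + m *: v)) (x - p - 2 *: (w + m *: v)).
  exact: dotp_ge0.
have E1 : dotp (x - p - 2 *: (w + m *: v)) (x - p - 2 *: (w + m *: v)) =
   sqdist x p - 4 * dotp (w + m *: v) (x - p) + 4 * dotp (w + m *: v) (w + m *: v).
  by rewrite sqdistE !coordE; ring.
have CS2 : 0 <= dotp (w - m *: v) (w - m *: v) by exact: dotp_ge0.
have E2 : dotp (w + m *: v) (w + m *: v) =
   2 * dotp w w + 2 * m ^+ 2 * dotp v v - dotp (w - m *: v) (w - m *: v).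
  by rewrite !coordE; ring.
have m2 : m ^+ 2 <= 1 by rewrite expr2; nra.
have h1 : m ^+ 2 * dotp v v <= dotp v v by rewrite ler_piMl.
have h2 : k * m ^+ 2 <= k by rewrite ler_piMr.
rewrite E1 in CS; rewrite E2 in CS.
have : M <= (M + 1) ^+ 2 by rewrite expr2; nra.
by rewrite /M; lra.
Qed.

(** An intersection of closed half spaces, bounded because a covering of radius [r] admits no larger
    empty circle. *)
Lemma feasible_compact (X : set 'rV[R]_2) p r : covering r X ->
  compact [set z : 'rV[R]_2 * R | feasible X p z.1 z.2].
Proof.
move=> cX.
have r0 : 0 <= r ^+ 2 by exact: sqr_ge0.
(* From [x^2 <= r^2] follows [|x| <= r^2 + 1] whatever the sign of [r]. *)
apply: (@subclosed_compact _ _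
  ([set w : 'rV[R]_2 | forall i, w ord0 i \in `[- (r ^+ 2 + 1), r ^+ 2 + 1]]
   `*` `[0, r ^+ 2])).
- have cfst (j : 'I_2) : continuous (fun z : 'rV[R]_2 * R => z.1 0 j).
    move=> z; apply: (@continuous_comp _ _ _ fst (fun w : 'rV[R]_2 => w 0 j)).
      exact: cvg_fst.
    exact: continuous_coord.
  have csnd : continuous (fun z : 'rV[R]_2 * R => z.2) by move=> z; exact: cvg_snd.
  have ccst (c : R) : continuous (fun z : 'rV[R]_2 * R => c).
    exact: cst_continuous.
  rewrite (_ : [set z | _] = (fun z : 'rV[R]_2 * R => z.2) @^-1` [set t | 0 <= t] `&`
    \bigcap_(x in X) (fun z : 'rV[R]_2 * R => sqdist x p + (-1) * z.2 +
       (- (2 * (x 0 0 - p 0 0))) * z.1 0 0 + (- (2 * (x 0 1 - p 0 1))) * z.1 0 1)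
         @^-1` [set t | 0 <= t]).
    apply: closedI.
      by apply: closed_comp => [z _|]; [exact: csnd|exact: closed_ge].
    apply: closed_bigI => x _; apply: closed_comp => [z _|]; last exact: closed_ge.
    apply: continuous_addr; last by apply: continuous_mulr.
    apply: continuous_addr; last by apply: continuous_mulr.
    by apply: continuous_addr; [exact: ccst|apply: continuous_mulr].
  apply/seteqP; split=> -[w t] /= [t0 h]; split=> // x /h;
    by rewrite /= !coordE; lra.
- apply: compact_setX; last exact: segment_compact.
  apply: (@rV_compact R 2 (fun=> [set` `[- (r ^+ 2 + 1), r ^+ 2 + 1]])) => _.
  exact: segment_compact.
- move=> [w t] /= /[dup] fe /(feasible_bounded cX) b; case: fe => t0 _.
  rewrite dotpE in b; split=> /=; last by rewrite in_itv /= t0 /=; nra.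
  suff h (j : 'I_2) : w ord0 j ^+ 2 <= r ^+ 2.
    by move=> i; rewrite in_itv /=; have := h i; nra.
  have [->|->] : j = 0 \/ j = 1; last 2 first.
  - by nra.
  - by nra.
  by case: j => -[|[|//]] i; [left|right]; apply/val_inj.
Qed.

(** If all active points had [dotp v (x - p) < 0], a step along [v] would raise [t]. If all were
    orthogonal to [v], steps along [v] and [- v] would both keep [t], and one of them would increase
    [|w|]. *)
Lemma extremal_circle (X : set 'rV[R]_2) p r :
  (forall x y, X x -> X y -> x <> y -> 4 <= sqdist x y) -> covering r X ->
  exists o (s2 : R), [/\ s2 <= r ^+ 2, forall x, X x -> s2 <= sqdist x o &
    forall v, v <> 0 ->
      (exists x, [/\ X x, sqdist x o = s2 & 0 <= dotp v (x - p)]) /\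
      (exists x, [/\ X x, sqdist x o = s2 & dotp v (x - p) <> 0])].
Proof.
move=> X4 cX; pose C := [set z : 'rV[R]_2 * R | feasible X p z.1 z.2].
have cC : compact C := feasible_compact cX.
have C0 : C !=set0.
  exists (0, 0); split=> //= x _.
  by rewrite (_ : dotp 0 _ = 0) ?mulr0 ?subr0 ?sqdist_ge0 // !coordE; ring.
have csnd : continuous (fun z : 'rV[R]_2 * R => z.2) by move=> z; exact: cvg_snd.
have [[w1 t] /set_mem /= Cw1 tmax] :=
  compact_EVT_max C0 cC (continuous_subspaceT csnd).
(* The second maximization runs over the optimal face of the first. *)
pose C' := C `&` [set z | z.2 = t].
have cC' : compact C'.
  apply: compact_closedI => //.
  rewrite (_ : [set z | _] = (fun z : 'rV[R]_2 * R => z.2) @^-1` [set t]) //.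
  by apply: closed_comp => [z _|]; [exact: csnd|exact: closed_eq].
have cq : continuous (fun z : 'rV[R]_2 * R => sqdist z.1 0).
  move=> z; apply: (@continuous_comp _ _ _ fst (fun w => sqdist w 0)).
    exact: cvg_fst.
  exact: continuous_sqdist.
have C'0 : C' !=set0 by exists (w1, t).
have [[w t'] /set_mem [/= Cw t't] wmax] :=
  compact_EVT_max C'0 cC' (continuous_subspaceT cq).
rewrite t't in Cw wmax *.
have {}wmax w' : feasible X p w' t -> dotp w' w' <= dotp w w.
  move=> f'; have := wmax (w', t); rewrite /sqdist !subr0; apply.
  by apply/mem_set; split.
have {}tmax w' t'' : feasible X p w' t'' -> t'' <= t.
  by move=> f'; have := tmax (w', t''); apply; apply/mem_set.
exists (p + w), (t + dotp w w); split.
- exact: feasible_bounded Cw.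
- by case/feasible_sqdist : Cw.
have actE x : t + dotp w w = sqdist x (p + w) <-> t = sqdist x p - 2 * dotp w (x - p).
  by rewrite !sqdistE !coordE; split; lra.
move=> v v0; split.
- apply: contrapT => nx.
  have [|x Xx /actE tx|e e0 /tmax] := @feasible_perturb X p w t v 1 _ X4 Cw.
  + by [].
  + right; rewrite ltNge; apply/negP => vx.
    by apply: nx; exists x.
  + by rewrite mul1r; nra.
- apply: contrapT => nx.
  have vx x : X x -> t = sqdist x p - 2 * dotp w (x - p) -> dotp v (x - p) = 0.
    move=> Xx /actE tx; apply: contrapT => vx.
    by apply: nx; exists x.
  have pert u : (u = v \/ u = - v) ->
      exists2 e, 0 < e & dotp w u * 2 + e * dotp v v <= 0.
    move=> uv.
    have [|x Xx /(vx x Xx) tx|e e0 h] := @feasible_perturb X p w t u 0 _ X4 Cw.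
    + by [].
    + left; split=> //; case: uv => -> //.
      by move: tx; rewrite !coordE; lra.
    have duu : dotp u u = dotp v v by case: uv => -> //; rewrite !coordE; ring.
    exists e => //; rewrite mul0r addr0 in h.
    have := wmax _ h.
    rewrite (_ : dotp (w + _) _ = dotp w w + e * (dotp w u * 2 + e * dotp u u)).
      by rewrite gerDl pmulr_rle0 // duu.
    by rewrite !coordE; ring.
  have [e e0 h] := pert v (or_introl erefl).
  have [e' e'0 h'] := pert (- v) (or_intror erefl).
  have := dotp_gt0 v0.
  rewrite (_ : dotp w (- v) = - dotp w v) in h'; last by rewrite !coordE; ring.
  by nra.
Qed.

End Holes.

(** * Triangles *)

Section Triangles.
Variable R : realType.
Implicit Types (a b c o p q u v w : 'rV[R]_2) (r s t k : R).

Definition barycentric a b c q : Prop := exists s t u : R,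
  [/\ 0 <= s, 0 <= t, 0 <= u, s + t + u = 1 & q = s *: a + t *: b + u *: c].

Lemma convex_setP (A : set 'rV[R]_2) : convex_set A <->
  forall p q s t, A p -> A q -> 0 <= s -> 0 <= t -> s + t = 1 ->
    A (s *: p + t *: q).
Proof.
split=> [cA p q s t Ap Aq s0 t0 st|h].
  have s1 : s <= 1 by lra.
  have := cA p q (Itv01 s0 s1) (mem_set Ap) (mem_set Aq) => /set_mem.
  by rewrite /conv /= /unstable.onem (_ : 1 - s = t) //; lra.
move=> x y l /set_mem Ax /set_mem Ay; apply/mem_set; apply: h => //.
  by rewrite /= subr_ge0.
by rewrite /= /unstable.onem addrC subrK.
Qed.

Lemma convex_hull_convex (A : set 'rV[R]_2) p q s t :
  convex_hull A p -> convex_hull A q -> 0 <= s -> 0 <= t -> s + t = 1 ->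
  convex_hull A (s *: p + t *: q).
Proof.
move=> Ap Aq s0 t0 st M [cM AM].
by apply: (convex_setP M).1 => //; [exact: Ap|exact: Aq].
Qed.

Lemma sub_convex_hull (A : set 'rV[R]_2) : A `<=` convex_hull A.
Proof. exact: sub_gen_smallest. Qed.

Lemma convex_hull_sub (A B : set 'rV[R]_2) :
  convex_set B -> A `<=` B -> convex_hull A `<=` B.
Proof. by move=> cB AB; exact: smallest_sub. Qed.

Lemma convex_hull_is_convex (A : set 'rV[R]_2) : convex_set (convex_hull A).
Proof. by apply/convex_setP => *; exact: convex_hull_convex. Qed.

Lemma convex_hullS (A B : set 'rV[R]_2) :
  A `<=` B -> convex_hull A `<=` convex_hull B.
Proof.
move=> AB; apply: convex_hull_sub; first exact: convex_hull_is_convex.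
exact: subset_trans AB (@sub_convex_hull B).
Qed.

Lemma convex_hull3E a b c :
  convex_hull [set a; b; c] = [set q | barycentric a b c q].
Proof.
apply/seteqP; split.
  apply: convex_hull_sub; last first.
    move=> _ [[->|->]|->].
    - by exists 1, 0, 0; split; rewrite ?scale1r ?scale0r ?addr0 ?add0r.
    - by exists 0, 1, 0; split; rewrite ?scale1r ?scale0r ?addr0 ?add0r.
    - by exists 0, 0, 1; split; rewrite ?scale1r ?scale0r ?addr0 ?add0r.
  apply/convex_setP => _ _ s t [s1 [t1 [u1 [s10 t10 u10 e1 ->]]]]
    [s2 [t2 [u2 [s20 t20 u20 e2 ->]]]] s0 t0 st.
  exists (s * s1 + t * s2), (s * t1 + t * t2), (s * u1 + t * u2); split.
  - by rewrite addr_ge0 ?mulr_ge0.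
  - by rewrite addr_ge0 ?mulr_ge0.
  - by rewrite addr_ge0 ?mulr_ge0.
  - rewrite [LHS](_ : _ = s * (s1 + t1 + u1) + t * (s2 + t2 + u2)); last by ring.
    by rewrite e1 e2 !mulr1.
  - by apply: rV2P; rewrite !mxE; ring.
move=> q [s [t [u [s0 t0 u0 e ->]]]].
have ha : convex_hull [set a; b; c] a by apply: sub_convex_hull; left; left.
have hb : convex_hull [set a; b; c] b by apply: sub_convex_hull; left; right.
have hc : convex_hull [set a; b; c] c by apply: sub_convex_hull; right.
have [u1|u1] := eqVneq u 1.
  have -> : s = 0 by lra.
  have -> : t = 0 by lra.
  by rewrite u1 !scale0r !add0r scale1r.
have d0 : 0 < s + t.
  rewrite lt_def addr_ge0 // andbT.
  by apply: contra u1 => /eqP h; apply/eqP; lra.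
rewrite (_ : _ + _ = (s + t) *: ((s / (s + t)) *: a + (t / (s + t)) *: b) + u *: c).
  apply: convex_hull_convex => //; last exact: ltW.
  apply: convex_hull_convex; rewrite ?divr_ge0 ?(ltW d0) //.
  by rewrite -mulrDl divff // gt_eqF.
rewrite scalerDr !scalerA !mulrA ![(s + t) * _]mulrC !mulrK //;
  by rewrite unitfE gt_eqF.
Qed.

(** Leibniz' identity for a barycentre. With [o] the circumcentre it yields both that the triangle
    lies in its circumdisk and that each of its points has a vertex within the circumradius. *)
Lemma leibniz a b c q (s t u : R) o : s + t + u = 1 ->
  q = s *: a + t *: b + u *: c ->
  s * sqdist a o + t * sqdist b o + u * sqdist c o =
  sqdist q o + (s * sqdist a q + t * sqdist b q + u * sqdist c q).
Proof.
move=> e ->; rewrite !sqdistE !coordE.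
by rewrite (_ : s = 1 - t - u); [ring|lra].
Qed.

Lemma dotp_comb u a b c (s t k : R) :
  dotp u (s *: a + t *: b + k *: c) = s * dotp u a + t * dotp u b + k * dotp u c.
Proof. by rewrite !coordE; ring. Qed.

Lemma hull_le u k a b c q : dotp u a <= k -> dotp u b <= k -> dotp u c <= k ->
  convex_hull [set a; b; c] q -> dotp u q <= k.
Proof.
move=> ha hb hc; rewrite convex_hull3E => -[s [t [l [s0 t0 l0 e ->]]]].
by rewrite dotp_comb; nra.
Qed.

(** Twice the signed area. *)
Definition area a b c : R :=
  (b 0 0 - a 0 0) * (c 0 1 - a 0 1) - (b 0 1 - a 0 1) * (c 0 0 - a 0 0).

(** The square of the formula which equates the product of the sides with four times circumradius
    times area. With [c] as origin, the two bisector equations are solved for the centre by Cramer's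
    rule. *)
Lemma area_sqdist a b c o s : sqdist a o = s -> sqdist b o = s ->
  sqdist c o = s ->
  sqdist a b * sqdist b c * sqdist c a = 4 * s * area a b c ^+ 2.
Proof.
rewrite !sqdistE /area => ha hb hc.
set A0 := a 0 0 - c 0 0; set A1 := a 0 1 - c 0 1.
set B0 := b 0 0 - c 0 0; set B1 := b 0 1 - c 0 1.
set O0 := o 0 0 - c 0 0; set O1 := o 0 1 - c 0 1.
have eA : 2 * (A0 * O0 + A1 * O1) = A0 ^+ 2 + A1 ^+ 2 by rewrite /A0 /A1 /O0 /O1; nra.
have eB : 2 * (B0 * O0 + B1 * O1) = B0 ^+ 2 + B1 ^+ 2 by rewrite /B0 /B1 /O0 /O1; nra.
have eO : s = O0 ^+ 2 + O1 ^+ 2 by rewrite -hc /O0 /O1; ring.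
have e0 : 2 * (A0 * B1 - A1 * B0) * O0 =
    (A0 ^+ 2 + A1 ^+ 2) * B1 - (B0 ^+ 2 + B1 ^+ 2) * A1.
  by rewrite -eA -eB; ring.
have e1 : 2 * (A0 * B1 - A1 * B0) * O1 =
    (B0 ^+ 2 + B1 ^+ 2) * A0 - (A0 ^+ 2 + A1 ^+ 2) * B0.
  by rewrite -eA -eB; ring.
rewrite (_ : _ - (b 0 1 - a 0 1) * _ = A0 * B1 - A1 * B0); last first.
  by rewrite /A0 /A1 /B0 /B1; ring.
rewrite (_ : 4 * s * _ = (2 * (A0 * B1 - A1 * B0) * O0) ^+ 2 +
  (2 * (A0 * B1 - A1 * B0) * O1) ^+ 2); last by rewrite eO; ring.
by rewrite e0 e1 /A0 /A1 /B0 /B1; ring.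
Qed.

Lemma area_neq0 a b c o s : sqdist a o = s -> sqdist b o = s ->
  sqdist c o = s -> a <> b -> b <> c -> c <> a -> area a b c != 0.
Proof.
move=> ha hb hc /sqdist_gt0 ab /sqdist_gt0 bc /sqdist_gt0 ca.
apply: contraTneq (mulr_gt0 (mulr_gt0 ab bc) ca) => e.
by rewrite (area_sqdist ha hb hc) e expr0n mulr0 ltxx.
Qed.

Lemma area_rot a b c : area b c a = area a b c.
Proof. by rewrite /area; ring. Qed.

(** Barycentric coordinates are quotients of areas. Multiplying by [area a b c] makes the sign
    conditions independent of the orientation. *)
Lemma barycentric_area a b c q : area a b c != 0 ->
  0 <= area q b c * area a b c -> 0 <= area q c a * area a b c ->
  0 <= area q a b * area a b c -> barycentric a b c q.
Proof.
set D := area a b c => D0 h1 h2 h3.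
have D2 : 0 < D ^+ 2 by rewrite lt_def sqr_ge0 sqrf_eq0 D0.
have U : D ^+ 2 \is a GRing.unit by rewrite unitfE gt_eqF.
exists (area q b c * D / D ^+ 2), (area q c a * D / D ^+ 2), (area q a b * D / D ^+ 2).
have E : area q b c + area q c a + area q a b = D by rewrite /D /area; ring.
split; rewrite ?divr_ge0 ?(ltW D2) //.
  by rewrite -!mulrDl E -expr2 divrr.
have S (x y : R) : y * D = x -> y = x / D by move=> <-; rewrite mulfK.
have E2 (x : R) : x * D / D ^+ 2 = x / D by field.
apply: rV2P; rewrite !mxE !E2 ![_ / D * _]mulrAC -!mulrDl; apply: S;
  by rewrite /D /area; ring.
Qed.

Lemma area_perp a b c : area a b c = dotp (perp (b - a)) c - dotp (perp (b - a)) a.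
Proof. by rewrite /area !coordE; ring. Qed.

Lemma interior_triangle a b c : area a b c != 0 ->
  interior (convex_hull [set a; b; c]) !=set0.
Proof.
move=> D0; set D := area a b c in D0.
have copen u v : open [set q | 0 < area u v q * D].
  rewrite (_ : [set q | _] =
    (fun q => dotp (D *: perp (v - u)) q) @^-1`
      [set x | D * dotp (perp (v - u)) u < x]).
    by apply: open_comp; [move=> ? _; exact: continuous_dotp|exact: open_gt].
  apply/seteqP; split=> q /=; rewrite area_perp !coordE => h; rewrite -subr_gt0;
    by move: h; rewrite -subr_gt0; congr (0 < _); ring.
(* The centroid lies strictly on the inner side of all three edges. *)
exists (3^-1 *: (a + b + c)).
have : open ([set q | 0 < area b c q * D] `&` [set q | 0 < area c a q * D] `&`
             [set q | 0 < area a b q * D]).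
  by apply: openI => //; apply: openI.
rewrite openE => /(_ (3^-1 *: (a + b + c))) H.
have D2 : 0 < D ^+ 2 / 3 by rewrite divr_gt0 // lt_def sqr_ge0 sqrf_eq0 D0.
have /H : ([set q | 0 < area b c q * D] `&` [set q | 0 < area c a q * D] `&`
             [set q | 0 < area a b q * D]) (3^-1 *: (a + b + c)).
  split; [split|] => /=; move: D2; congr (0 < _);
  by rewrite /D /area !mxE; field.
apply: interiorS => q [[/= /ltW h1 /ltW h2] /ltW h3].
rewrite convex_hull3E /=; apply: barycentric_area => //; rewrite -/D;
  by rewrite -area_rot.
Qed.

(** Split along [v4]: two vectors at obtuse angles to [v4] and to each other have components across
    [v4] of opposite signs. Three numbers cannot have pairwise opposite signs. *)
Lemma four_obtuse (v1 v2 v3 v4 : 'rV[R]_2) :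
  dotp v1 v2 < 0 -> dotp v2 v3 < 0 -> dotp v1 v3 < 0 ->
  dotp v1 v4 < 0 -> dotp v2 v4 < 0 -> dotp v3 v4 < 0 -> False.
Proof.
move=> h12 h23 h13 h14 h24 h34.
have n4 : 0 <= dotp v4 v4 by exact: dotp_ge0.
have key u v : dotp u v < 0 -> dotp u v4 < 0 -> dotp v v4 < 0 ->
    dotp (perp v4) u * dotp (perp v4) v < 0.
  move=> huv hu hv.
  rewrite (_ : _ * _ = dotp v4 v4 * dotp u v - dotp u v4 * dotp v v4).
    rewrite subr_lt0 (@le_lt_trans _ _ 0) // ?mulr_ge0_le0 ?(ltW huv) //.
    by rewrite nmulr_rgt0.
  by rewrite !coordE; ring.
have := key _ _ h12 h14 h24; have := key _ _ h23 h24 h34; have := key _ _ h13 h14 h34.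
set x := dotp _ v1; set y := dotp _ v2; set z := dotp _ v3 => xz yz xy.
have : 0 < (x * z) * (y * z) by rewrite nmulr_rgt0.
rewrite (_ : _ * _ = x * y * z ^+ 2); last by ring.
by rewrite ltNge mulr_le0_ge0 ?sqr_ge0 // ltW.
Qed.

(** With at most two points in [S] some [v] violates the assumption: a common normal when the points
    lie on one line with [p], otherwise a normal of the line through both, directed so that both
    products are negative. *)
Lemma extremal_three (S : set 'rV[R]_2) p :
  (forall v, v <> 0 -> (exists2 x, S x & 0 <= dotp v (x - p)) /\
     (exists2 x, S x & dotp v (x - p) <> 0)) ->
  exists a b c, [/\ S a, S b & S c] /\ [/\ a <> b, b <> c & c <> a].
Proof.
move=> H.
have vec10 : vec2 1 0 <> 0 :> 'rV[R]_2.
  by move=> /(congr1 (fun u : 'rV[R]_2 => u 0 0)) /eqP; rewrite !coordE oner_eq0.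
have [[a Sa _] _] := H _ vec10.
have pz u : u <> 0 -> perp u <> 0 by move=> u0 /perp_eq0.
have [b Sb ba] : exists2 b, S b & b <> a.
  apply: contrapT => nb.
  have allS x : S x -> x = a by move=> Sx; apply: contrapT => xa; apply: nb; exists x.
  have [ap|/eqP ap] := eqVneq (a - p) 0.
    have [_ [x /allS ->]] := H _ vec10; rewrite ap; apply.
    by rewrite !coordE; ring.
  have [_ [x /allS ->]] := H _ (pz _ ap); apply; exact: dotp_perp.
have [c [Sc ca cb]] : exists c, [/\ S c, c <> a & c <> b]; last first.
  by exists a, b, c; split=> //; split=> // /esym.
apply: contrapT => nc.
have allS x : S x -> x = a \/ x = b.
  move=> Sx; have [|/eqP xa] := eqVneq x a; first by left.
  have [|/eqP xb] := eqVneq x b; first by right.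
  by exfalso; apply: nc; exists x.
pose D := dotp (perp (a - p)) (b - p).
have [D0|D0] := eqVneq D 0.
  have [ap|/eqP ap] := eqVneq (a - p) 0.
    have bp : b - p <> 0.
      move=> /eqP bp; apply: ba; move/eqP: ap; move: bp.
      by rewrite !subr_eq0 => /eqP-> /eqP->.
    have [_ [x /allS [->|->]]] := H _ (pz _ bp); apply; last exact: dotp_perp.
    by rewrite ap !coordE; ring.
  have [_ [x /allS [->|->]]] := H _ (pz _ ap); apply; last exact: D0.
  exact: dotp_perp.
have D2 : 0 < D ^+ 2 by rewrite lt_def sqr_ge0 sqrf_eq0 D0.
(* The factor [D] fixes the direction of the normal. *)
have Ea : dotp (D *: perp (b - a)) (a - p) = - D ^+ 2 by rewrite /D !coordE; ring.
have Eb : dotp (D *: perp (b - a)) (b - p) = - D ^+ 2 by rewrite /D !coordE; ring.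
have v0 : D *: perp (b - a) <> 0.
  by move=> v0; move: Ea D2; rewrite v0 !coordE; lra.
have [[x Sx vx] _] := H _ v0.
by move: vx; case: (allS x Sx) => ->; rewrite ?Ea ?Eb; lra.
Qed.

(** If [p] lay beyond the side opposite to some vertex, the normal of that side pointing towards [p]
    would have negative product with all three vectors from [p] to the vertices. *)
Lemma extremal_hull a b c p : area a b c != 0 ->
  (forall v, v <> 0 ->
     [\/ 0 <= dotp v (a - p), 0 <= dotp v (b - p) | 0 <= dotp v (c - p)]) ->
  convex_hull [set a; b; c] p.
Proof.
rewrite convex_hull3E => D0 H.
have key a' b' c' : area a' b' c' != 0 -> (forall v, v <> 0 ->
     [\/ 0 <= dotp v (a' - p), 0 <= dotp v (b' - p) | 0 <= dotp v (c' - p)]) ->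
    0 <= area p b' c' * area a' b' c'.
  move=> {}D0 {}H; rewrite leNgt; apply/negP => n.
  set D := area a' b' c' in D0 n; pose v := - D *: perp (c' - b').
  have D2 : 0 < D ^+ 2 by rewrite lt_def sqr_ge0 sqrf_eq0 D0.
  have Eb : dotp v (b' - p) = area p b' c' * D by rewrite /v /area !coordE; ring.
  have Ec : dotp v (c' - p) = area p b' c' * D by rewrite /v /area !coordE; ring.
  have Ea : dotp v (a' - p) = area p b' c' * D - D ^+ 2.
    by rewrite /v /D /area !coordE; ring.
  have v0 : v <> 0 by move=> v0; move: Eb n; rewrite v0 !coordE; lra.
  by case: (H v v0); rewrite ?Ea ?Eb ?Ec; lra.
apply: barycentric_area => //.
- exact: key.
- rewrite -(area_rot a b c); apply: key; first by rewrite area_rot.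
  by move=> v /H [h|h|h]; [exact: Or33|exact: Or31|exact: Or32].
- rewrite -(area_rot a b c) -(area_rot b c a); apply: key.
    by rewrite (area_rot b c a) (area_rot a b c).
  by move=> v /H [h|h|h]; [exact: Or32|exact: Or33|exact: Or31].
Qed.

End Triangles.

(** * Vertices and faces of triangles *)

Section Delaunay.
Variable R : realType.
Implicit Types (a b c o p q u v w : 'rV[R]_2) (r s t k : R).

(** On a circle of squared radius [s], two points at squared distance at least 4 satisfy
    [dotp (x - o) (y - o) <= s - 2 < 0]. *)
Lemma circle_three (X : set 'rV[R]_2) o s a b c d :
  (forall x y, X x -> X y -> x <> y -> 4 <= sqdist x y) -> s < 2 ->
  X a -> X b -> X c -> X d -> a <> b -> b <> c -> c <> a ->
  sqdist a o = s -> sqdist b o = s -> sqdist c o = s -> sqdist d o = s ->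
  [set a; b; c] d.
Proof.
move=> X4 s2 Xa Xb Xc Xd ab bc ca ha hb hc hd; apply: contrapT => nd.
have da : a <> d by move=> e; apply: nd; left; left.
have db : b <> d by move=> e; apply: nd; left; right.
have dc : c <> d by move=> e; apply: nd; right.
have key x y : X x -> X y -> sqdist x o = s -> sqdist y o = s -> x <> y ->
    dotp (x - o) (y - o) < 0.
  move=> Xx Xy hx hy xy; have := X4 x y Xx Xy xy.
  have : sqdist x y = sqdist x o + sqdist y o - 2 * dotp (x - o) (y - o).
    by rewrite !sqdistE !coordE; ring.
  by rewrite hx hy; lra.
apply: (@four_obtuse R (a - o) (b - o) (c - o) (d - o)); apply: key => //.
by move=> /esym.
Qed.

Lemma sqdist_hull a b c o s q : sqdist a o = s -> sqdist b o = s ->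
  sqdist c o = s -> convex_hull [set a; b; c] q -> sqdist q o <= s.
Proof.
move=> ha hb hc; rewrite convex_hull3E => -[x [y [z [x0 y0 z0 e eq]]]].
have := leibniz o e eq; rewrite ha hb hc -!mulrDl e mul1r => ->.
by rewrite lerDl !addr_ge0 ?mulr_ge0 ?sqdist_ge0.
Qed.

(** By Leibniz the weighted mean of the squared distances from [q] to the vertices is
    [s - |q - o|^2], so they cannot all exceed [s]. *)
Lemma nearest_vertex a b c o s q : sqdist a o = s -> sqdist b o = s ->
  sqdist c o = s -> convex_hull [set a; b; c] q ->
  exists2 v, [set a; b; c] v & sqdist v q <= s.
Proof.
move=> ha hb hc; rewrite convex_hull3E => -[x [y [z [x0 y0 z0 e eq]]]].
have := leibniz o e eq; rewrite ha hb hc -!mulrDl e mul1r => E.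
have q0 := sqdist_ge0 q o.
apply: contrapT => h.
have far v : [set a; b; c] v -> s < sqdist v q.
  by move=> Vv; rewrite ltNge; apply/negP => vs; apply: h; exists v.
have fa := far a (or_introl (or_introl erefl)).
have fb := far b (or_introl (or_intror erefl)).
have fc := far c (or_intror erefl).
have pos (t d : R) : 0 <= t -> s < d ->
    0 <= t * (d - s) /\ (t * (d - s) <= 0 -> t <= 0).
  move=> t0 sd; split; first by rewrite mulr_ge0 // subr_ge0 ltW.
  by rewrite pmulr_lle0 // subr_gt0.
have [xa xa'] := pos _ _ x0 fa; have [yb yb'] := pos _ _ y0 fb.
have [zc zc'] := pos _ _ z0 fc.
have Es : x * s + y * s + z * s = s by rewrite -!mulrDl e mul1r.
have hx : x <= 0 by apply: xa'; lra.
have hy : y <= 0 by apply: yb'; lra.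
have hz : z <= 0 by apply: zc'; lra.
by lra.
Qed.

Lemma hull_vertex a b c v : [set a; b; c] v -> convex_hull [set a; b; c] v.
Proof. exact: sub_convex_hull. Qed.

Lemma hull_halfplane u k a b c :
  convex_hull [set a; b; c] `<=` halfplane u k <->
  [/\ dotp u a <= k, dotp u b <= k & dotp u c <= k].
Proof.
split=> [h|[ha hb hc] q]; last exact: hull_le.
by split; apply: h; apply: hull_vertex; [left; left|left; right|right].
Qed.

(** A linear functional attains its maximum over a triangle only at combinations of vertices where
    it is maximal. This governs the faces below. *)
Lemma extreme_weight (x y z A B C k : R) :
  0 < x -> 0 <= y -> 0 <= z -> x + y + z = 1 -> A <= k -> B <= k -> C <= k ->
  x * A + y * B + z * C = k -> A = k.
Proof.
move=> x0 y0 z0 e Ak Bk Ck E; apply/eqP; rewrite eq_le Ak /= -subr_le0.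
rewrite -(pmulr_rle0 _ x0).
have h1 : 0 <= y * (k - B) by rewrite mulr_ge0 // subr_ge0.
have h2 : 0 <= z * (k - C) by rewrite mulr_ge0 // subr_ge0.
have Ek : x * k + y * k + z * k = k by rewrite -!mulrDl e mul1r.
by lra.
Qed.

Lemma vertices_sub a b c : vertices (convex_hull [set a; b; c]) `<=` [set a; b; c].
Proof.
move=> v [u [k [_ /hull_halfplane[ha hb hc] E]]].
have [] : (convex_hull [set a; b; c] `&` line u k) v by rewrite -E.
have hv x : [set a; b; c] x -> dotp u x = k -> x = v.
  move=> Vx ux; have : (convex_hull [set a; b; c] `&` line u k) x.
    by split=> //; exact: hull_vertex.
  by rewrite -E.
rewrite {1}convex_hull3E => -[x [y [z [x0 y0 z0 e eq]]]] uv.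
have {eq uv}uv : x * dotp u a + y * dotp u b + z * dotp u c = k.
  by rewrite -dotp_comb -eq.
have [xp|xn] := ltP 0 x.
  left; left; apply: esym; apply: hv; first by left; left.
  exact: (extreme_weight xp y0 z0 e ha hb hc uv).
have [yp|yn] := ltP 0 y.
  left; right; apply: esym; apply: hv; first by left; right.
  by apply: (extreme_weight yp x0 z0 _ hb ha hc); lra.
right; apply: esym; apply: hv; first by right.
by apply: (@extreme_weight z x y _ _ _ k _ x0 y0 _ hc ha hb); lra.
Qed.

Lemma vertices_hull a b c o s : 0 < s -> sqdist a o = s -> sqdist b o = s ->
  sqdist c o = s -> vertices (convex_hull [set a; b; c]) = [set a; b; c].
Proof.
move=> s0 ha hb hc; apply/seteqP; split; first exact: vertices_sub.
move=> v Vv.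
have hv : sqdist v o = s by move: Vv => [[->|->]|->].
have E x : sqdist x v = sqdist x o - s - 2 * (dotp (v - o) x - dotp (v - o) v).
  by rewrite -hv !sqdistE !coordE; ring.
(* The supporting line is the tangent of the circumcircle at [v]; it meets the circumdisk in [v]
   alone. *)
exists (v - o), (dotp (v - o) v); split.
- move=> /eqP; rewrite subr_eq0 => /eqP vo.
  by move: s0; rewrite -hv vo sqdistE !subrr; lra.
- apply/hull_halfplane; split.
  + by have := sqdist_ge0 a v; rewrite E; lra.
  + by have := sqdist_ge0 b v; rewrite E; lra.
  + by have := sqdist_ge0 c v; rewrite E; lra.
- apply/seteqP; split=> [_ ->|q [Tq]]; first by split; [exact: hull_vertex|].
  rewrite /line /= => uq; apply/eqP; rewrite -sqdist_eq0 E uq subrr mulr0 subr0.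
  rewrite eq_le; apply/andP; split.
    by rewrite subr_le0; exact: sqdist_hull Tq.
  by have := sqdist_ge0 q v; rewrite E uq; lra.
Qed.

(** A supporting line cuts out the hull of the vertices on it. The eight cases list which vertices
    these are; all three are excluded. *)
Lemma face_cases u k a b c : a <> b -> b <> c -> c <> a ->
  dotp u a <= k -> dotp u b <= k -> dotp u c <= k ->
  ~ (dotp u a = k /\ dotp u b = k /\ dotp u c = k) ->
  let F := convex_hull [set a; b; c] `&` line u k in
  let V := [set x | [set a; b; c] x /\ dotp u x = k] in
  [\/ F = set0, (exists2 v, V v & F = [set v]) |
      (exists v w, [/\ V v, V w, v <> w & F = convex_hull [set v; w]])].
Proof.
move=> ab bc ca ha hb hc nabc F V.
have Va : dotp u a = k -> V a by split=> //; left; left.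
have Vb : dotp u b = k -> V b by split=> //; left; right.
have Vc : dotp u c = k -> V c by split=> //; right.
have VF x : V x -> F x by move=> [Vx ux]; split=> //; exact: hull_vertex.
have VVF x y : V x -> V y -> convex_hull [set x; y] `<=` F.
  move=> /VF Vx /VF Vy; apply: convex_hull_sub => [|_ [->|->]] //.
  apply/convex_setP => p q s t [Tp up] [Tq uq] s0 t0 st; split.
    exact: convex_hull_convex.
  rewrite /line /= in up uq *.
  rewrite (_ : dotp u _ = s * dotp u p + t * dotp u q); last by rewrite !coordE; ring.
  by rewrite up uq -mulrDl st mul1r.
have comb x y s t : 0 <= s -> 0 <= t -> s + t = 1 ->
    convex_hull [set x; y] (s *: x + t *: y).
  move=> s0 t0 st; apply: convex_hull_convex => //; apply: sub_convex_hull;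
    by [left|right].
have FE q : F q -> exists s t l : R, [/\ 0 <= s, 0 <= t, 0 <= l, s + t + l = 1 &
    [/\ q = s *: a + t *: b + l *: c, (dotp u a < k -> s = 0),
        (dotp u b < k -> t = 0) & (dotp u c < k -> l = 0)]].
  move=> [/[!convex_hull3E] -[s [t [l [s0 t0 l0 e ->]]]]].
  rewrite /line /= dotp_comb => uq.
  have nz (x y z A B C : R) : 0 <= x -> 0 <= y -> 0 <= z -> x + y + z = 1 ->
      A <= k -> B <= k -> C <= k -> x * A + y * B + z * C = k -> A < k -> x = 0.
    move=> x0 y0 z0 exyz hA hB hC E; apply: contraTeq => xn0.
    rewrite -leNgt (@extreme_weight x y z A B C k) //.
    by rewrite lt_def xn0.
  exists s, t, l; split=> //; split=> //.
  - exact: (nz _ _ _ _ _ _ s0 t0 l0 e ha hb hc uq).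
  - by apply: (nz _ _ _ _ _ _ t0 s0 l0 _ hb ha hc); lra.
  - by apply: (nz _ _ _ _ _ _ l0 s0 t0 _ hc ha hb); lra.
have singl x : V x -> (forall q, F q -> q = x) -> F = [set x].
  by move=> Vx h; apply/seteqP; split=> [q /h|_ ->] //; exact: VF.
have [ea|na] := eqVneq (dotp u a) k; have [eb|nb] := eqVneq (dotp u b) k;
  have [ec|nc] := eqVneq (dotp u c) k.
- by exfalso; apply: nabc.
- apply: Or33; exists a, b; split=> //; [exact: Va|exact: Vb|].
  apply/seteqP; split; last exact: VVF (Va ea) (Vb eb).
  move=> q /FE [s [t [l [s0 t0 l0 e [-> _ _ l1]]]]].
  rewrite l1 ?lt_neqAle ?nc // in e *; rewrite scale0r addr0; apply: comb => //; lra.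
- apply: Or33; exists a, c; split=> //; [exact: Va|exact: Vc|exact: nesym|].
  apply/seteqP; split; last exact: VVF (Va ea) (Vc ec).
  move=> q /FE [s [t [l [s0 t0 l0 e [-> _ t1 _]]]]].
  rewrite t1 ?lt_neqAle ?nb // in e *; rewrite scale0r addr0; apply: comb => //; lra.
- apply: Or32; exists a; [exact: Va|apply: singl; first exact: Va].
  move=> q /FE [s [t [l [s0 t0 l0 e [-> _ t1 l1]]]]].
  rewrite t1 ?lt_neqAle ?nb // l1 ?lt_neqAle ?nc // in e *.
  by rewrite !scale0r !addr0 (_ : s = 1) ?scale1r //; lra.
- apply: Or33; exists b, c; split=> //; [exact: Vb|exact: Vc|].
  apply/seteqP; split; last exact: VVF (Vb eb) (Vc ec).
  move=> q /FE [s [t [l [s0 t0 l0 e [-> s1 _ _]]]]].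
  rewrite s1 ?lt_neqAle ?na // in e *; rewrite scale0r add0r; apply: comb => //; lra.
- apply: Or32; exists b; [exact: Vb|apply: singl; first exact: Vb].
  move=> q /FE [s [t [l [s0 t0 l0 e [-> s1 _ l1]]]]].
  rewrite s1 ?lt_neqAle ?na // l1 ?lt_neqAle ?nc // in e *.
  by rewrite !scale0r add0r addr0 (_ : t = 1) ?scale1r //; lra.
- apply: Or32; exists c; [exact: Vc|apply: singl; first exact: Vc].
  move=> q /FE [s [t [l [s0 t0 l0 e [-> s1 t1 _]]]]].
  rewrite s1 ?lt_neqAle ?na // t1 ?lt_neqAle ?nb // in e *.
  by rewrite !scale0r !add0r (_ : l = 1) ?scale1r //; lra.
- apply: Or31; apply/seteqP; split=> // q /FE [s [t [l [s0 t0 l0 e [_ s1 t1 l1]]]]].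
  move: e; rewrite s1 ?lt_neqAle ?na // t1 ?lt_neqAle ?nb // l1 ?lt_neqAle ?nc //.
  by rewrite /=; lra.
Qed.

End Delaunay.

(** * Delaunay decompositions *)

Section Rigid.
Variable R : realType.
Implicit Types (a b c o p q u v w : 'rV[R]_2) (r s t k g : R).

(** [s] is the squared radius. Further points of [X] on the circle are allowed; for [s < 2] they are
    ruled out by [circle_three]. *)
Definition delaunay_circle (X : set 'rV[R]_2) o s a b c : Prop :=
  [/\ [/\ X a, X b & X c], [/\ a <> b, b <> c & c <> a],
      [/\ sqdist a o = s, sqdist b o = s & sqdist c o = s] &
      forall x, X x -> s <= sqdist x o].

Lemma area_orthogonal u a b c k : area a b c != 0 ->
  dotp u a = k -> dotp u b = k -> dotp u c = k -> u = 0.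
Proof.
move=> D0; rewrite !dotpE => ha hb hc.
have e0 : u 0 0 * area a b c = 0.
  rewrite (_ : _ * _ = (u 0 0 * b 0 0 + u 0 1 * b 0 1) * (c 0 1 - a 0 1)
    - (u 0 0 * a 0 0 + u 0 1 * a 0 1) * (c 0 1 - b 0 1)
    - (u 0 0 * c 0 0 + u 0 1 * c 0 1) * (b 0 1 - a 0 1)); last by rewrite /area; ring.
  by rewrite ha hb hc; ring.
have e1 : u 0 1 * area a b c = 0.
  rewrite (_ : _ * _ = (u 0 0 * c 0 0 + u 0 1 * c 0 1) * (b 0 0 - a 0 0)
    + (u 0 0 * a 0 0 + u 0 1 * a 0 1) * (c 0 0 - b 0 0)
    - (u 0 0 * b 0 0 + u 0 1 * b 0 1) * (c 0 0 - a 0 0)); last by rewrite /area; ring.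
  by rewrite ha hb hc; ring.
apply: rV2P; rewrite mxE; apply/eqP.
  by move/eqP: e0; rewrite mulf_eq0 (negPf D0) orbF.
by move/eqP: e1; rewrite mulf_eq0 (negPf D0) orbF.
Qed.

Section Decomposition.
Variables (X : set 'rV[R]_2) (g : R).
Hypothesis X4 : forall x y, X x -> X y -> x <> y -> 4 <= sqdist x y.
Hypothesis g0 : 0 < g.
Hypothesis g2 : g ^+ 2 < 2.
Hypothesis cX : covering g X.
(** Optimality of [g] enters the construction only here: the circles given by [extremal_circle] have
    squared radius at most [g ^+ 2], hence exactly that. *)
Hypothesis rigid : forall o s a b c,
  delaunay_circle X o s a b c -> s <= g ^+ 2 -> s = g ^+ 2.

Let gg : 0 < g ^+ 2. Proof. by rewrite exprn_gt0. Qed.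

Definition delaunay_cells : set (set 'rV[R]_2) :=
  [set T | exists o a b c, delaunay_circle X o (g ^+ 2) a b c /\
                           T = convex_hull [set a; b; c]].

Lemma delaunay_cells_cover p : exists2 T, delaunay_cells T & T p.
Proof.
have [ o [s [sg hole ext]]] := extremal_circle p X4 cX.
have [ |a [b [c [[[Xa ha] [Xb hb] [Xc hc]] [ab bc ca]]]]] :=
    @extremal_three R [set x | X x /\ sqdist x o = s] p.
  by move=> v /ext[[x [? ? ?]] [y [? ? ?]]]; split; [exists x|exists y].
have dc : delaunay_circle X o s a b c by [].
have sE := rigid dc sg.
exists (convex_hull [set a; b; c]); first by exists o, a, b, c; rewrite -sE.
apply: extremal_hull; first exact: (area_neq0 ha hb hc).
move=> v /ext[[x [Xx hx vx]] _].
(* The active point found for [v] depends on [v]; as the circle carries only three points, it is one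
   of the chosen vertices. *)
have [[xE|xE]|xE] : [set a; b; c] x.
- by apply: (circle_three X4 _ Xa Xb Xc Xx ab bc ca ha hb hc hx); rewrite sE.
- by apply: Or31; rewrite -xE.
- by apply: Or32; rewrite -xE.
- by apply: Or33; rewrite -xE.
Qed.

Lemma delaunay_cells_polygon T : delaunay_cells T -> convex_polygon T.
Proof.
move=> [ o [a [b [c [[_ [ab bc ca] [ha hb hc] _] ->]]]]].
exists [set a; b; c]; split=> //.
by apply: interior_triangle; exact: (area_neq0 ha hb hc).
Qed.

Lemma delaunay_cells_vertices o a b c : delaunay_circle X o (g ^+ 2) a b c ->
  vertices (convex_hull [set a; b; c]) = X `&` [set x | sqdist x o = g ^+ 2].
Proof.
move=> [[Xa Xb Xc] [ab bc ca] [ha hb hc] _]; rewrite (vertices_hull gg ha hb hc).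
apply/seteqP; split=> [_ [[->|->]|->]|x [Xx hx]] //.
exact: (circle_three X4 g2 Xa Xb Xc Xx ab bc ca ha hb hc hx).
Qed.

(** The radical axis has normal [o' - o] and this level. For equal radii it is the perpendicular
    bisector of the centres. *)
Definition radical_level o o' : R := (dotp o' o' - dotp o o) / 2.

Lemma radical_sqdist o o' x :
  sqdist x o - sqdist x o' = 2 * (dotp (o' - o) x - radical_level o o').
Proof. by rewrite !sqdistE /radical_level !coordE; field. Qed.

(* Both circles being empty, each triangle lies on its own side of their
   radical axis, and meets it in the hull of the common vertices. *)
Lemma delaunay_cells_radical o o' a b c a' b' c' :
  let u := o' - o in let k := radical_level o o' in
  let T := convex_hull [set a; b; c] in
  let T' := convex_hull [set a'; b'; c'] in
  delaunay_circle X o (g ^+ 2) a b c -> delaunay_circle X o' (g ^+ 2) a' b' c' ->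
  T <> T' ->
  [/\ u <> 0, T `<=` halfplane u k, T `&` line u k `<=` T' &
    [\/ T `&` line u k = set0,
        (exists2 v, vertices T v & T `&` line u k = [set v]) |
        exists v w, v <> w /\ T `&` line u k = convex_hull [set v; w]]].
Proof.
move=> u k T T' dT dT' TT'.
have := delaunay_cells_vertices dT; have := delaunay_cells_vertices dT'.
case: (dT) => [[Xa Xb Xc] [ab bc ca] [ha hb hc] hX].
case: (dT') => [[Xa' Xb' Xc'] [ab' bc' ca'] [ha' hb' hc'] hX'].
rewrite (vertices_hull gg ha hb hc) (vertices_hull gg ha' hb' hc') => V' V.
(* Equal centres would give the same points of [X] on the circle, hence the same triangle. *)
have oo' : u <> 0.
  by move=> /subr0_eq oo; apply: TT'; rewrite /T /T' V V' oo.
have side x : X x -> sqdist x o = g ^+ 2 ->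
    dotp u x <= k /\ (dotp u x = k -> sqdist x o' = g ^+ 2).
  move=> Xx hx; have := hX' x Xx; have := radical_sqdist o o' x.
  by rewrite hx -/u -/k; split; lra.
have [ua ea] := side a Xa ha; have [ub eb] := side b Xb hb.
have [uc ec] := side c Xc hc.
have memT' x : [set a; b; c] x -> dotp u x = k -> T' x.
  by rewrite V => -[Xx /side h] /(h Xx).2 hx; apply: hull_vertex; rewrite V'.
split=> //; first exact/hull_halfplane.
  have := @face_cases R u k a b c ab bc ca ua ub uc _.
  case=> [[ka [kb kc]]|->|[v [Vv uv] ->]|[v [w [[Vv uv] [Vw uw] vw ->]]]] //.
  - exfalso; apply: oo'; apply: (area_orthogonal _ ka kb kc).
    exact: (area_neq0 ha hb hc).
  - by move=> _ ->; exact: memT'.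
  - apply: convex_hull_sub; first exact: convex_hull_is_convex.
    by move=> _ [->|->]; exact: memT'.
have := @face_cases R u k a b c ab bc ca ua ub uc _.
case=> [[ka [kb kc]]|->|[v [Vv uv] ->]|[v [w [[Vv uv] [Vw uw] vw ->]]]].
- exfalso; apply: oo'; apply: (area_orthogonal _ ka kb kc).
  exact: (area_neq0 ha hb hc).
- exact: Or31.
- by apply: Or32; exists v => //; rewrite (vertices_hull gg ha hb hc).
- by apply: Or33; exists v, w.
Qed.

Lemma radical_opp o o' : o - o' = - (o' - o) /\
  radical_level o' o = - radical_level o o'.
Proof. by rewrite opprB /radical_level; split=> //; field. Qed.

Lemma halfplane_opp u k : halfplane (- u) (- k) = cohalfplane u k.
Proof.
rewrite /halfplane /cohalfplane; apply/seteqP; split=> q /=;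
  by rewrite (_ : dotp (- u) q = - dotp u q) ?lerN2 // !coordE; ring.
Qed.

Lemma line_opp u k : line (- u) (- k) = line u k.
Proof.
rewrite /line; apply/seteqP; split=> q /=;
  rewrite (_ : dotp (- u) q = - dotp u q); try (by rewrite !coordE; ring).
  by move/oppr_inj.
by move=> ->.
Qed.

(** The radical axis does not depend on the order of the circles, so the one-sided statement applies
    to both triangles. *)
Lemma delaunay_cells_meet o o' a b c a' b' c' :
  let u := o' - o in let k := radical_level o o' in
  let T := convex_hull [set a; b; c] in
  let T' := convex_hull [set a'; b'; c'] in
  delaunay_circle X o (g ^+ 2) a b c -> delaunay_circle X o' (g ^+ 2) a' b' c' ->
  T <> T' ->
  [/\ u <> 0, T `<=` halfplane u k, T' `<=` cohalfplane u k,
    T `&` T' = T `&` line u k & T `&` T' = T' `&` line u k].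
Proof.
move=> u k T T' dT dT' TT'.
have [u0 hT sT _] := delaunay_cells_radical dT dT' TT'.
have [_] := delaunay_cells_radical dT' dT (nesym TT').
rewrite (radical_opp o o').1 (radical_opp o o').2 halfplane_opp line_opp.
move=> hT' sT' _.
split=> //; apply/seteqP; split=> q [].
- move=> Tq T'q; split=> //; apply/eqP; rewrite eq_le.
  by apply/andP; split; [exact: hT|exact: hT'].
- by move=> Tq kq; split=> //; apply: sT.
- move=> Tq T'q; split=> //; apply/eqP; rewrite eq_le.
  by apply/andP; split; [exact: hT|exact: hT'].
- by move=> T'q kq; split=> //; apply: sT'.
Qed.

(** A common interior point would lie on the radical axis; moving it along the normal would leave
    the half plane of the first triangle. *)
Lemma delaunay_cells_disjoint T T' : delaunay_cells T -> delaunay_cells T' ->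
  T <> T' -> interior T `&` interior T' = set0.
Proof.
move=> [ o [a [b [c [dT ->]]]]] [ o' [a' [b' [c' [dT' ->]]]]] TT'.
have [/dotp_gt0 u0 hT hT' _ _] := delaunay_cells_meet dT dT' TT'.
set u := o' - o in u0 hT hT'; set k := radical_level o o' in hT hT'.
apply/seteqP; split=> // z [iT /interior_subset/hT' zT'].
have [e e0 /(_ e)] := near_line u iT.
rewrite gtr0_norm // lexx => /(_ isT)/hT.
rewrite /halfplane /cohalfplane /= in zT' *.
rewrite (_ : dotp u _ = dotp u z + e * dotp u u); last by rewrite !coordE; ring.
have : 0 < e * dotp u u by rewrite mulr_gt0.
by lra.
Qed.

Lemma delaunay_cells_edge_to_edge : edge_to_edge delaunay_cells.
Proof.
move=> _ _ [ o [a [b [c [dT ->]]]]] [ o' [a' [b' [c' [dT' ->]]]]] TT'.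
have [u0 hT hT' E E'] := delaunay_cells_meet dT dT' TT'.
have [_ _ _] := delaunay_cells_radical dT dT' TT'.
set T := convex_hull _; set T' := convex_hull [set a'; b'; c'].
set u := o' - o in u0 hT hT' E E' *; set k := radical_level o o' in hT hT' E E' *.
have fT : face T (T `&` T') by exists u, k.
have fT' : face T' (T `&` T').
  exists (- u), (- k); rewrite halfplane_opp line_opp; split=> // /eqP.
  by rewrite oppr_eq0 => /eqP.
rewrite -E => -[->|[v Vv Ev]|[v [w [vw Ev]]]].
- exact: Or31.
- by apply: Or32; exists v; split=> //; rewrite /vertices /= -Ev.
- apply: Or33; exists (T `&` T'); split=> //; split=> //; exists v, w; split=> //.
Qed.

Lemma delaunay_cells_locally_finite : locally_finite delaunay_cells.
Proof.
move=> p r.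
(* Two uses of [sqdist_le2], through a common point [q] and the centre, bound the squared distance
   from [p] to a vertex by [8 g^2 + 2 r^2]. The added 1 makes this number at most its own square, so
   it also serves as a radius. *)
pose A := X `&` disk p (8 * g ^+ 2 + 2 * r ^+ 2 + 1).
have fA : finite_set A by exact: finite_disk.
apply: (@sub_finite_set _ _
  [set convex_hull [set z.1.1; z.1.2; z.2] | z in A `*` A `*` A]); last first.
  by apply: finite_image; apply: finite_setX => //; exact: finite_setX.
move=> _ [[ o [a [b [c [[[Xa Xb Xc] _ [ha hb hc] _] ->]]]]] [q [Tq qp]]].
have r0 : 0 <= r by rewrite (le_trans _ qp) // edist_ge0.
have qo := sqdist_hull ha hb hc Tq.
rewrite /disk /= edist_le // in qp.
have near x : X x -> sqdist x o = g ^+ 2 -> A x.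
  move=> Xx hx; split=> //; rewrite /disk /= edist_le; last first.
    by have := gg; have := sqr_ge0 r; lra.
  have := sqdist_le2 x p q; have := sqdist_le2 x q o; rewrite (sqdistC o q) hx.
  have := gg; have := sqr_ge0 r; set M := _ + 1 => ? ? ? ?.
  have M1 : 1 <= M by rewrite /M; lra.
  suff : M <= M ^+ 2 by rewrite {1}/M; lra.
  by rewrite expr2 ler_peMr //; lra.
by exists ((a, b), c) => //; split; [split|]; apply: near.
Qed.

Lemma delaunay_cells_circle T : delaunay_cells T ->
  vertices T `<=` X /\ exists c r, [/\ vertices T `<=` circle c r,
    X `&` interior (disk c r) = set0 & X `&` circle c r `<=` vertices T].
Proof.
move=> [ o [a [b [c [dT ->]]]]]; rewrite (delaunay_cells_vertices dT).
have E x : circle o g x <-> sqdist x o = g ^+ 2.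
  rewrite /circle /=; split=> [|/eqP]; first by rewrite -sqr_edist => ->.
  by rewrite -edist_eq ?ltW // => /eqP.
split; first exact: subIsetl.
exists o, g; split.
- by move=> x [_ /E].
- rewrite interior_disk; apply/seteqP; split=> // x [/=].
  by rewrite edist_lt ?ltW // ltNge => Xx; case: dT => _ _ _ ->.
- by move=> x [Xx /E].
Qed.

Lemma rigid_delaunay (K : set (set 'rV[R]_2)) :
  (forall o a b c, delaunay_circle X o (g ^+ 2) a b c ->
     K (convex_hull [set a; b; c])) ->
  delaunay_triangles_tile_congruently X K.
Proof.
move=> hK.
have cover : \bigcup_(T in delaunay_cells) T = setT.
  by apply/seteqP; split=> // p _; have [T ? ?] := delaunay_cells_cover p; exists T.
have triE : triangular_cells delaunay_cells = delaunay_cells.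
  apply/seteqP; split=> T; first by case.
  move=> DT; split=> //; split; first exact: delaunay_cells_polygon.
  by case: DT => o [a [b [c [_ ->]]]]; exists a, b, c.
have hullX : convex_hull X = setT.
  rewrite -cover; apply/seteqP.
  split=> [p _|p [_ [_ [a [b [c [[[Xa Xb Xc] _ _ _] ->]]]]]]].
    by rewrite cover.
  by apply: convex_hullS => _ [[->|->]|->].
have til : tiling setT delaunay_cells.
  by split; [exact: delaunay_cells_polygon|exact: cover|exact: delaunay_cells_disjoint].
exists delaunay_cells; rewrite triE; split=> //.
- split.
  + by rewrite hullX.
  + exact: delaunay_cells_locally_finite.
  + exact: delaunay_cells_edge_to_edge.
  + exact: delaunay_cells_circle.
- move=> T DT; exists T; split.
    by case: DT => o [a [b [c [dT ->]]]]; exact: hK dT.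
  by exists id; split=> //; rewrite image_id.
Qed.

End Decomposition.

(** * From a tiling by congruent triangles back to a covering *)

(** [congruent] provides a mere distance-preserving map. Up to a translation it preserves scalar
    products, hence is linear, so supporting lines can be pulled back along it. *)
Lemma isometry_affine (f : 'rV[R]_2 -> 'rV[R]_2) u k :
  (forall p q, edist (f p) (f q) = edist p q) -> u <> 0 ->
  exists u' k', u' <> 0 /\ forall p, dotp u (f p) - k = dotp u' p - k'.
Proof.
move=> fi u0.
pose h p := f p - f 0.
have hd p q : sqdist (h p) (h q) = sqdist p q.
  by rewrite -[RHS]sqr_edist -fi sqr_edist /sqdist /h opprB addrA subrK.
have h0 : h 0 = 0 by rewrite /h subrr.
have hn p : dotp (h p) (h p) = dotp p p.
  by have := hd p 0; rewrite /sqdist h0 !subr0.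
have hp p q : dotp (h p) (h q) = dotp p q.
  have E x y : sqdist x y = dotp x x + dotp y y - 2 * dotp x y.
    by rewrite sqdistE !dotpE; ring.
  by have := hd p q; rewrite !E !hn; lra.
pose e := h (vec2 1 0); pose e' := h (vec2 0 1).
have ee : dotp e e = 1 by rewrite hp !coordE; ring.
have ee' : dotp e e' = 0 by rewrite hp !coordE; ring.
have e'e' : dotp e' e' = 1 by rewrite hp !coordE; ring.
have hE p : h p = p 0 0 *: e + p 0 1 *: e'.
  apply/eqP; rewrite -subr_eq0 -dotp_eq0.
  have he : dotp (h p) e = p 0 0 by rewrite hp !coordE; ring.
  have he' : dotp (h p) e' = p 0 1 by rewrite hp !coordE; ring.
  (* The squared norm of [h p - p 0 0 *: e - p 0 1 *: e'] expands to 0. *)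
  rewrite (_ : dotp _ _ = dotp (h p) (h p) - 2 * p 0 0 * dotp (h p) e
    - 2 * p 0 1 * dotp (h p) e' + p 0 0 ^+ 2 * dotp e e + p 0 1 ^+ 2 * dotp e' e'
    + 2 * p 0 0 * p 0 1 * dotp e e').
    by rewrite hn he he' ee ee' e'e' dotpE; apply/eqP; ring.
  by rewrite !coordE; ring.
exists (vec2 (dotp u e) (dotp u e')), (k - dotp u (f 0)); split.
  move=> z; have ue : dotp u e = 0.
    by move: (congr1 (fun v : 'rV[R]_2 => v 0 0) z); rewrite vec2_0 mxE.
  have ue' : dotp u e' = 0.
    by move: (congr1 (fun v : 'rV[R]_2 => v 0 1) z); rewrite vec2_1 mxE.
  have := dotp_gt0 u0.
  (* The second factor is the Gram determinant of [e] and [e'], equal to 1; the product is a form in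
     [dotp u e] and [dotp u e'], which vanish. *)
  rewrite (_ : dotp u u = (dotp u u) * (dotp e e * dotp e' e' - dotp e e' ^+ 2)).
    rewrite (_ : _ * _ = dotp u e ^+ 2 * dotp e' e' + dotp u e' ^+ 2 * dotp e e
      - 2 * dotp u e * dotp u e' * dotp e e').
      by rewrite ue ue' ee'; rewrite expr0n /= !mul0r mulr0 !addr0 subrr ltxx.
    by rewrite !dotpE; ring.
  by rewrite ee ee' e'e'; ring.
move=> p; rewrite -[f p](subrK (f 0)) -/(h p) hE !coordE; ring.
Qed.

(** The vertex near [f p] belongs to the model triangle [T0], while a Delaunay cell only guarantees
    that its exposed points lie in [X]. The vertex is therefore transported back together with its
    supporting line. *)
Lemma tile_covering (X : set 'rV[R]_2) (K : set (set 'rV[R]_2)) g : 0 < g ->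
  (forall T, K T -> exists o a b c, [/\ T = convex_hull [set a; b; c],
     sqdist a o = g ^+ 2, sqdist b o = g ^+ 2 & sqdist c o = g ^+ 2]) ->
  delaunay_triangles_tile_congruently X K -> covering g X.
Proof.
move=> g0 hK [D [[_ _ _ hD] [_ cov _] cong]]; apply/coveringP => p.
have [T DT Tp] : (\bigcup_(T in triangular_cells D) T) p by rewrite cov.
have [T0 [/hK[ o [a [b [c [T0E ha hb hc]]]]] [f [fi fT]]]] := cong T DT.
have T0p : T0 (f p) by rewrite -fT; exists p.
rewrite T0E in T0p fT; have [v Vv vp] := nearest_vertex ha hb hc T0p.
move: (Vv); rewrite -(vertices_hull _ ha hb hc) ?exprn_gt0 //.
move=> [u [k [u0 hu Ev]]].
have [v' Tv' fv'] : (f @` T) v by rewrite fT; exact: hull_vertex.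
have [u' [k' [u'0 hu']]] := isometry_affine k fi u0.
have Vv' : vertices T v'.
  exists u', k'; split=> //.
    move=> q Tq; rewrite /halfplane /= -subr_le0 -hu' subr_le0; apply: hu.
    by rewrite -fT; exists q.
  apply/seteqP; split=> [_ ->|q [Tq uq]].
    split=> //; apply/eqP; rewrite -subr_eq0 -hu' fv' subr_eq0; apply/eqP.
    have : [set v] v by [].
    by rewrite Ev => -[].
  have : [set v] (f q).
    rewrite Ev; split; first by rewrite -fT; exists q.
    by apply/eqP; rewrite -subr_eq0 hu' subr_eq0; apply/eqP.
  move=> /= fq; apply/eqP; rewrite -sqdist_eq0 -sqr_edist -fi fq fv'.
  by rewrite sqr_edist sqdist_eq0.
exists v'; first exact: (hD T DT.1).1.
by rewrite -fi fv' edistC edist_le // ltW.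
Qed.

End Rigid.

(** * Altitudes and circumradius *)

Section Separation.
Variable R : realType.
Implicit Types (a b c o p q u v w : 'rV[R]_2) (r s t k g lam : R).

(* The point [a] lies beyond a strip of width [2 * lam] bounding [b] and [c]. *)
Definition isolated lam a b c : Prop := exists e : 'rV[R]_2,
  [/\ dotp e e = 1, 2 * lam <= dotp e (b - a) & 2 * lam <= dotp e (c - a)].

Lemma isolatedC lam a b c : isolated lam a b c -> isolated lam a c b.
Proof. by move=> [e [? ? ?]]; exists e. Qed.

(** The line separating [a] from [b] misses the open disk about [c], so this disk lies on one side,
    together with that of [a] or of [b]. The centre left alone is [2 * lam] away from the others
    across the line. *)
Lemma separable_isolated lam (X : set 'rV[R]_2) a b c : 0 <= lam ->
  totally_separable lam X -> X a -> X b -> X c -> a <> b ->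
  isolated lam a b c \/ isolated lam b a c.
Proof.
move=> lam0 sX Xa Xb Xc ab; have [u [k [/dotp_gt0 u0 ha hb hX]]] := sX a b Xa Xb ab.
pose n := Num.sqrt (dotp u u).
have n0 : 0 < n by rewrite sqrtr_gt0.
have nn : n ^+ 2 = dotp u u by rewrite sqr_sqrtr // ltW.
pose e := n^-1 *: u.
have un : u = n *: e by rewrite scalerA divff ?gt_eqF // scale1r.
have ee : dotp e e = 1.
  rewrite (_ : dotp e e = dotp u u / n ^+ 2); last first.
    by rewrite /e !coordE; field; rewrite gt_eqF.
  by rewrite nn divff ?gt_eqF.
clearbody e.
have ue x : dotp u x = n * dotp e x by rewrite {1}un !coordE; ring.
pose h := k / n.
have kh : k = n * h by rewrite /h mulrC divfK ?gt_eqF.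
have inD c' t : `|t| <= lam -> disk c' lam (c' + t *: e).
  move=> tl; rewrite /disk /= edist_le // sqdistE !coordE.
  rewrite (_ : _ + _ = t ^+ 2 * dotp e e); last by rewrite dotpE; ring.
  by rewrite ee mulr1 -(real_normK (num_real t)) ler_sqr ?nnegrE.
have et c' t : dotp e (c' + t *: e) = dotp e c' + t.
  rewrite (_ : dotp e _ = dotp e c' + t * dotp e e); last by rewrite !coordE; ring.
  by rewrite ee mulr1.
have hae : dotp e a + lam <= h.
  have := ha _ (inD a lam _); rewrite ger0_norm // lexx => /(_ isT).
  by rewrite /halfplane /= ue et kh ler_pM2l.
have hbe : h <= dotp e b - lam.
  have := hb _ (inD b (- lam) _); rewrite normrN ger0_norm // lexx => /(_ isT).
  by rewrite /cohalfplane /= ue et kh ler_pM2l.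
have eB x y : dotp e (x - y) = dotp e x - dotp e y by rewrite !coordE; ring.
have [hc|hc] : h + lam <= dotp e c \/ dotp e c <= h - lam.
- have [|hc1] := leP (h + lam) (dotp e c); first by left.
  have [|hc2] := leP (dotp e c) (h - lam); first by right.
  (* Otherwise the foot of the perpendicular from [c] would be a point of the line inside the
     disk. *)
  exfalso; have : (line u k `&` interior (disk c lam)) (c + (h - dotp e c) *: e).
    split; first by rewrite /line /= ue et kh; congr (n * _); ring.
    rewrite interior_disk /= edist_lt // sqdistE !coordE -dotpE.
    rewrite (_ : _ + _ = (h - dotp e c) ^+ 2 * dotp e e); last by rewrite !dotpE; ring.
    by rewrite ee mulr1; nra.
  by rewrite hX.
- by left; exists e; split; rewrite ?eB //; lra.
- right; exists (- e); split.
  + by rewrite -ee !coordE; ring.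
  + by rewrite (_ : dotp (- e) _ = dotp e b - dotp e a); [lra|rewrite !coordE; ring].
  + by rewrite (_ : dotp (- e) _ = dotp e b - dotp e c); [lra|rewrite !coordE; ring].
Qed.

Lemma sqdist_dotp a b c :
  2 * dotp (a - b) (c - b) = sqdist a b + sqdist b c - sqdist c a.
Proof. by rewrite !sqdistE !coordE; ring. Qed.

(* The vector [w] is [|b - c|^2] times the altitude from [a]. *)
Lemma isolated_altitude lam a b c : 0 <= lam -> b <> c -> isolated lam a b c ->
  sqdist a b <= sqdist b c + sqdist c a -> sqdist c a <= sqdist a b + sqdist b c ->
  4 * lam ^+ 2 * sqdist b c <= area a b c ^+ 2.
Proof.
move=> lam0 /sqdist_gt0 bc [e [ee eb ec]] ab ca.
have tb := sqdist_dotp a b c; have tc := sqdist_dotp a c b.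
rewrite (sqdistC c b) (sqdistC a c) (sqdistC b a) in tc.
(* Up to the factor [sqdist b c], these are the barycentric weights of the foot of the altitude;
   they are nonnegative since the angles at [b] and [c] are not obtuse. *)
pose s := dotp (a - c) (b - c); pose t := dotp (a - b) (c - b).
have s0 : 0 <= s by rewrite /s; lra.
have t0 : 0 <= t by rewrite /t; lra.
have st : s + t = sqdist b c by rewrite /s /t; lra.
pose w := s *: (b - a) + t *: (c - a).
have ew : 2 * lam * sqdist b c <= dotp e w.
  rewrite (_ : dotp e w = s * dotp e (b - a) + t * dotp e (c - a)).
    by rewrite -st mulrDr lerD // mulrC ler_wpM2l.
  by rewrite /w !coordE; ring.
have ww : dotp w w = sqdist b c * area a b c ^+ 2.
  by rewrite /w /s /t !sqdistE /area !coordE; ring.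
have := cauchy_schwarz e w; rewrite ee mul1r ww => CS.
rewrite -(ler_pM2l bc); apply: le_trans CS.
rewrite [leLHS](_ : _ = (2 * lam * sqdist b c) ^+ 2); last by ring.
by rewrite ler_sqr ?nnegrE // ?(le_trans _ ew) // ?mulr_ge0 // ltW.
Qed.

(** * Inequalities for squared side lengths *)

Definition heron (P Q W : R) : R :=
  2 * (P * Q + Q * W + W * P) - (P ^+ 2 + Q ^+ 2 + W ^+ 2).

(** For squared sides, [s * heron P Q W = P * Q * W] now says that [s] is the squared circumradius,
    and [16 * lam ^+ 2 * P <= heron P Q W] that the altitude on side [P] is at least [2 * lam]. *)
Lemma heron_area a b c :
  heron (sqdist b c) (sqdist c a) (sqdist a b) = 4 * area a b c ^+ 2.
Proof. by rewrite /heron /area !sqdistE; ring. Qed.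

Lemma heron_rot (P Q W : R) : heron Q W P = heron P Q W.
Proof. by rewrite /heron; ring. Qed.

Lemma heron_sym (P Q W : R) : heron Q P W = heron P Q W.
Proof. by rewrite /heron; ring. Qed.

(** If [W >= P + Q >= 8], the circumdiameter is at least the side of square [W], so [4 s >= 8].
    Algebraically, [heron] is at most [4 P Q], while [P Q W >= 8 P Q]. *)
Lemma acute_of_circumradius (P Q W s : R) : 4 <= P -> 4 <= Q -> 4 <= W ->
  0 < heron P Q W -> s * heron P Q W = P * Q * W -> s < 2 -> W < P + Q.
Proof.
move=> P4 Q4 W4 K0 E s2; rewrite ltNge; apply/negP => PQW.
suff : 2 * heron P Q W <= s * heron P Q W by rewrite ler_pM2r // leNgt s2.
have PQ : 16 <= P * Q by nra.
rewrite E (_ : heron P Q W = 4 * (P * Q) - (W - P - Q) ^+ 2); last first.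
  by rewrite /heron; ring.
have := sqr_ge0 (W - P - Q); have : P * Q * 8 <= P * Q * W by rewrite ler_pM2l; lra.
by lra.
Qed.

(** [heron P Q W] is at most [P Q + Q W + W P], with defect half the sum of the squared differences,
    and sides of square at least 4 make this at most [3/4 P Q W]. *)
Lemma regular_bound (P Q W s : R) : 4 <= P -> 4 <= Q -> 4 <= W ->
  0 < heron P Q W -> s * heron P Q W = P * Q * W -> s <= 4 / 3 ->
  [/\ s = 4 / 3, P = 4, Q = 4 & W = 4].
Proof.
move=> P4 Q4 W4 K0 E s43.
have PQ : 0 < P * Q by nra.
have QW : 0 < Q * W by nra.
have WP : 0 < W * P by nra.
have K1 : heron P Q W <= P * Q + Q * W + W * P.
  rewrite -subr_ge0 (_ : _ - _ = ((P - Q) ^+ 2 + (Q - W) ^+ 2 + (W - P) ^+ 2) / 2).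
    by rewrite divr_ge0 ?addr_ge0 ?sqr_ge0.
  by rewrite /heron; field.
have h1 : 0 <= P * Q * (W - 4) by rewrite mulr_ge0 ?subr_ge0 // ltW.
have h2 : 0 <= Q * W * (P - 4) by rewrite mulr_ge0 ?subr_ge0 // ltW.
have h3 : 0 <= W * P * (Q - 4) by rewrite mulr_ge0 ?subr_ge0 // ltW.
have sK : s * heron P Q W <= 4 / 3 * heron P Q W by rewrite ler_pM2r.
have z (x y : R) : 0 < x -> x * (y - 4) <= 0 -> 4 <= y -> y = 4.
  move=> x0; rewrite pmulr_rle0 // subr_le0 => ? ?.
  by apply/eqP; rewrite eq_le; apply/andP.
have eP : P = 4 by apply: (z _ _ QW) => //; lra.
have eQ : Q = 4 by apply: (z _ _ WP) => //; lra.
have eW : W = 4 by apply: (z _ _ PQ) => //; lra.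
by split=> //; move: E; rewrite /heron eP eQ eW; lra.
Qed.

(* For fixed [Q] and [W] the altitude [heron P Q W / P] is largest at [P = Q];
   [t] is the ratio of base to leg of the resulting isosceles triangle. *)
Lemma legs_bound (P Q W s lam : R) : 0 < lam -> 4 <= P -> 4 <= Q -> 4 <= W ->
  Q <= P -> s * heron P Q W = P * Q * W -> s < 2 ->
  16 * lam ^+ 2 * P <= heron P Q W ->
  exists t, [/\ 0 < t < 2, W = t * Q, Q <= s * (4 - t),
    16 * lam ^+ 2 <= t * Q * (4 - t) & (Q = s * (4 - t) -> P = Q)].
Proof.
move=> lam0 P4 Q4 W4 QP E s2 alt.
have P0 : 0 < P by lra.
have Q0 : 0 < Q by lra.
have W0 : 0 < W by lra.
have K0 : 0 < heron P Q W.
  by apply: lt_le_trans alt; rewrite !mulr_gt0 // exprn_gt0.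
have s0 : 0 < s by rewrite -(pmulr_lgt0 _ K0) E !mulr_gt0.
(* Otherwise [P Q W - 2 heron = P W (Q - 4) + 2 W (W - 2 Q) + 2 (P - Q)^2] is nonnegative and
   [s >= 2]. *)
have W2Q : W < 2 * Q.
  rewrite ltNge; apply/negP => W2Q.
  suff : 2 * heron P Q W <= s * heron P Q W by rewrite ler_pM2r // leNgt s2.
  have PW : 0 < P * W by rewrite mulr_gt0.
  have h1 : 0 <= W * (W - 2 * Q) by rewrite mulr_ge0 ?subr_ge0 // ltW.
  have h2 : 0 <= P * W * (Q - 4) by rewrite mulr_ge0 ?subr_ge0 // ltW.
  have := sqr_ge0 (P - Q); rewrite E /heron; lra.
have d0 : 0 < Q * P - (Q - W) ^+ 2.
  have h1 : 0 < W * (2 * Q - W) by rewrite mulr_gt0 // subr_gt0.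
  have h2 : 0 <= Q * (P - Q) by rewrite mulr_ge0 ?subr_ge0 // ltW.
  by lra.
have [t tQ] : exists t, W = t * Q by exists (W / Q); rewrite divfK ?gt_eqF.
exists t; subst W.
have t0 : 0 < t by rewrite -(pmulr_lgt0 _ Q0).
have t2 : t < 2 by rewrite -(ltr_pM2r Q0).
set K' := heron P Q (t * Q) in E alt K0 *.
(* The subtracted product is nonnegative and vanishes only for [P = Q]. Dropping it gives both
   bounds, and equality in the first forces the triangle to be isosceles. *)
have K'E : K' = P * t * Q * (4 - t) - (P - Q) * (P - Q * (1 - t) ^+ 2).
  by rewrite /K' /heron; ring.
have d0' : 0 < P - Q * (1 - t) ^+ 2.
  rewrite -(pmulr_rgt0 _ Q0); move: d0; congr (0 < _); ring.
have D0 : 0 <= (P - Q) * (P - Q * (1 - t) ^+ 2).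
  by apply: mulr_ge0; [rewrite subr_ge0|exact: ltW].
have key : s * K' = P * t * Q ^+ 2 by rewrite E; ring.
have sle : s * K' <= s * (P * t * Q * (4 - t)) by rewrite ler_pM2l // K'E; lra.
have PtQ : 0 < P * t * Q by rewrite !mulr_gt0.
split=> //.
- by rewrite t0.
- by rewrite -(ler_pM2l PtQ); move: sle; rewrite key; lra.
- rewrite -(ler_pM2r P0); apply: le_trans alt _; rewrite K'E.
  by lra.
- move=> Qs; have /eqP : s * ((P - Q) * (P - Q * (1 - t) ^+ 2)) = 0.
    have : s * K' = P * t * Q * (s * (4 - t)) - s * ((P - Q) * (P - Q * (1 - t) ^+ 2)).
      by rewrite K'E; ring.
    by rewrite key -Qs; lra.
  by rewrite !mulf_eq0 (gt_eqF s0) (gt_eqF d0') /= orbF subr_eq0 => /eqP.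
Qed.

(** The bounds combine to [16 lam^2 <= s t (4 - t)^2], and [t (4 - t)^2] has maximum [256/27] at
    [t = 4/3]; the constant is [16 * 27 / 256 = 27/16]. *)
Lemma legs_bound_large (P Q W s lam : R) : 0 < lam -> 4 <= P -> 4 <= Q -> 4 <= W ->
  Q <= P -> s * heron P Q W = P * Q * W -> s < 2 ->
  16 * lam ^+ 2 * P <= heron P Q W -> s <= 27 / 16 * lam ^+ 2 ->
  [/\ s = 27 / 16 * lam ^+ 2, P = 9 / 2 * lam ^+ 2, Q = 9 / 2 * lam ^+ 2 &
      W = 6 * lam ^+ 2].
Proof.
move=> lam0 P4 Q4 W4 QP E s2 alt sl.
have [t [/andP[t0 t2] Wt Qs lamt PQ]] := legs_bound lam0 P4 Q4 W4 QP E s2 alt.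
have l0 : 0 < lam ^+ 2 by rewrite exprn_gt0.
have t4 : 0 < 4 - t by lra.
have tt : 0 < t * (4 - t) by rewrite mulr_gt0.
have h1 : t * (4 - t) * Q <= t * (4 - t) * (s * (4 - t)) by rewrite ler_pM2l.
have tt2 : 0 < t * (4 - t) ^+ 2 by rewrite mulr_gt0 // exprn_gt0.
have h2 : s * (t * (4 - t) ^+ 2) <= 27 / 16 * lam ^+ 2 * (t * (4 - t) ^+ 2).
  by rewrite ler_pM2r.
have h3 : 256 / 27 - t * (4 - t) ^+ 2 = (t - 4 / 3) ^+ 2 * (16 / 3 - t) by field.
have h4 : 27 / 16 * lam ^+ 2 * (256 / 27 - t * (4 - t) ^+ 2) <= 0.
  have -> : 27 / 16 * lam ^+ 2 * (256 / 27 - t * (4 - t) ^+ 2) =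
    16 * lam ^+ 2 - 27 / 16 * lam ^+ 2 * (t * (4 - t) ^+ 2) by field.
  by lra.
have {h4}: (t - 4 / 3) ^+ 2 <= 0.
  move: h4; rewrite pmulr_rle0; last by rewrite mulr_gt0.
  by rewrite h3 pmulr_lle0 //; lra.
move=> h4; have /eqP : (t - 4 / 3) ^+ 2 = 0 by apply/eqP; rewrite eq_le h4 sqr_ge0.
rewrite sqrf_eq0 subr_eq0 => /eqP tE; rewrite tE in Wt Qs lamt PQ.
have Q1 : Q = 9 / 2 * lam ^+ 2 by lra.
have s1 : s = 27 / 16 * lam ^+ 2 by lra.
split=> //; last by rewrite Wt Q1; field.
by rewrite PQ // Q1 s1; field.
Qed.

(** [2 - 2 d] is the smaller root of [t (4 - t) = 4 lam^2]. It is at most [4/3], and [t (4 - t)^2]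
    increases up to there, so a smaller [t] would violate the altitude bound. Then
    [4 <= Q <= s (4 - t) <= 2 s (1 + d) <= 4] is an equality. *)
Lemma legs_bound_middle (P Q W s lam d : R) : 0 < lam -> lam ^+ 2 = 1 - d ^+ 2 ->
  1 / 3 <= d -> d <= 1 / 2 -> 4 <= P -> 4 <= Q -> 4 <= W ->
  Q <= P -> s * heron P Q W = P * Q * W -> s < 2 ->
  16 * lam ^+ 2 * P <= heron P Q W -> s * (1 + d) <= 2 ->
  [/\ s * (1 + d) = 2, P = 4, Q = 4 & W = 8 - 8 * d].
Proof.
move=> lam0 lE d13 d12 P4 Q4 W4 QP E s2 alt sl.
have [t [/andP[t0 t2] Wt Qs lamt PQ]] := legs_bound lam0 P4 Q4 W4 QP E s2 alt.
have t4 : 0 < 4 - t by lra.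
have s0 : 0 < s by rewrite -(pmulr_lgt0 _ t4); lra.
have td : 2 - 2 * d <= t.
  rewrite leNgt; apply/negP => td.
  have tt : 0 < t * (4 - t) by rewrite mulr_gt0.
  have h1 : t * (4 - t) * Q <= t * (4 - t) * (s * (4 - t)) by rewrite ler_pM2l.
  (* In terms of the distance [y] below the maximizer [4/3], the deficit from the maximum is
     [y^2 (4 + y)]. *)
  pose x := 4 / 3 - (2 - 2 * d); pose y := 4 / 3 - t.
  have x0 : 0 <= x by rewrite /x; lra.
  have y0 : 0 < y by rewrite /y; lra.
  have h2 : t * (4 - t) ^+ 2 < (2 - 2 * d) * (2 + 2 * d) ^+ 2.
    rewrite -subr_gt0 (_ : _ - _ = (y - x) * (4 * (x + y) + x ^+ 2 + x * y + y ^+ 2)).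
      have h3 : 0 < y - x by rewrite /x /y; lra.
      have xy : 0 <= x * y by rewrite mulr_ge0 // ltW.
      by apply: mulr_gt0 => //; nra.
    by rewrite /x /y; field.
  have h3 : s * (t * (4 - t) ^+ 2) < s * ((2 - 2 * d) * (2 + 2 * d) ^+ 2).
    by rewrite ltr_pM2l.
  have h4 : s * ((2 - 2 * d) * (2 + 2 * d) ^+ 2) = 8 * lam ^+ 2 * (s * (1 + d)).
    by rewrite lE; ring.
  have h5 : 8 * lam ^+ 2 * (s * (1 + d)) <= 8 * lam ^+ 2 * 2.
    by apply: ler_wpM2l => //; rewrite mulr_ge0 ?sqr_ge0.
  by lra.
have h1 : s * (4 - t) <= s * (2 + 2 * d) by rewrite ler_pM2l //; lra.
have Q1 : Q = 4 by lra.
have s1 : s * (1 + d) = 2 by lra.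
have tE : t = 2 - 2 * d.
  have : s * (4 - t) = s * (2 + 2 * d) by lra.
  by move/(mulfI (lt0r_neq0 s0)); lra.
split=> //; last by rewrite Wt tE Q1; ring.
by rewrite PQ // Q1 tE; lra.
Qed.

End Separation.

(** * Extremal triangles and their lattices *)

Section Extremal.
Variable R : realType.
Implicit Types (a b c o p q u v w z : 'rV[R]_2) (r s t k g lam : R).

Lemma set3_rot a b c : [set b; c; a] = [set a; b; c].
Proof.
by apply/seteqP; split=> x [[]|] ->;
  [left; right|right|left; left|right|left; left|left; right].
Qed.

Lemma set3_swap a b c : [set b; a; c] = [set a; b; c].
Proof. by rewrite (setUC [set b]). Qed.

(* The two legs [b c] and [c a] are the sides whose altitudes are bounded below
   by separability. *)
Lemma separable_delaunay (X : set 'rV[R]_2) lam o s a b c : 0 < lam ->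
  (forall x y, X x -> X y -> x <> y -> 4 <= sqdist x y) ->
  totally_separable lam X -> delaunay_circle X o s a b c -> s < 2 ->
  exists a' b' c', [set a; b; c] = [set a'; b'; c'] /\
    let P := sqdist b' c' in let Q := sqdist c' a' in let W := sqdist a' b' in
    [/\ 4 <= P, 4 <= Q, 4 <= W & [/\ Q <= P, s * heron P Q W = P * Q * W &
      16 * lam ^+ 2 * P <= heron P Q W]].
Proof.
move=> lam0 X4 sX [[Xa Xb Xc] [ab bc ca] [ha hb hc] _] s2.
have P4 := X4 b c Xb Xc bc; have Q4 := X4 c a Xc Xa ca; have W4 := X4 a b Xa Xb ab.
have A0 : 0 < area a b c ^+ 2.
  by rewrite lt_def sqr_ge0 sqrf_eq0 (area_neq0 ha hb hc).
have E : s * heron (sqdist b c) (sqdist c a) (sqdist a b) =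
    sqdist b c * sqdist c a * sqdist a b.
  by rewrite heron_area; have := area_sqdist ha hb hc; lra.
have K0 : 0 < heron (sqdist b c) (sqdist c a) (sqdist a b) by rewrite heron_area; lra.
have aW := acute_of_circumradius P4 Q4 W4 K0 E s2.
have aP : sqdist b c < sqdist c a + sqdist a b.
  apply: (@acute_of_circumradius R _ _ _ s Q4 W4 P4) => //.
    by rewrite heron_rot.
  by rewrite heron_rot E; ring.
have aQ : sqdist c a < sqdist a b + sqdist b c.
  apply: (@acute_of_circumradius R _ _ _ s W4 P4 Q4) => //.
    by rewrite -heron_rot.
  by rewrite -heron_rot E; ring.
have l0 := ltW lam0.
have Ha : isolated lam a b c -> 4 * lam ^+ 2 * sqdist b c <= area a b c ^+ 2.
  by move=> i; apply: isolated_altitude => //; lra.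
have Hb : isolated lam b c a -> 4 * lam ^+ 2 * sqdist c a <= area a b c ^+ 2.
  by move=> i; rewrite -area_rot; apply: isolated_altitude => //; lra.
have Hc : isolated lam c a b -> 4 * lam ^+ 2 * sqdist a b <= area a b c ^+ 2.
  by move=> i; rewrite -area_rot -area_rot; apply: isolated_altitude => //; lra.
have sab := separable_isolated l0 sX Xa Xb Xc ab.
have sbc := separable_isolated l0 sX Xb Xc Xa bc.
have sca := separable_isolated l0 sX Xc Xa Xb ca.
(* Of the two sides with known altitudes, the longer one becomes [P]. *)
have key x y z : 4 <= sqdist y z -> 4 <= sqdist z x -> 4 <= sqdist x y ->
    s * heron (sqdist y z) (sqdist z x) (sqdist x y) =
      sqdist y z * sqdist z x * sqdist x y ->
    16 * lam ^+ 2 * sqdist y z <= heron (sqdist y z) (sqdist z x) (sqdist x y) ->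
    16 * lam ^+ 2 * sqdist z x <= heron (sqdist y z) (sqdist z x) (sqdist x y) ->
    exists a' b' c', [set x; y; z] = [set a'; b'; c'] /\
    let P := sqdist b' c' in let Q := sqdist c' a' in let W := sqdist a' b' in
    [/\ 4 <= P, 4 <= Q, 4 <= W & [/\ Q <= P, s * heron P Q W = P * Q * W &
      16 * lam ^+ 2 * P <= heron P Q W]].
  move=> yz zx xy Exyz hyz hzx; have [le|lt] := leP (sqdist z x) (sqdist y z).
    by exists x, y, z.
  exists y, x, z; rewrite set3_swap (sqdistC x z) (sqdistC z y) (sqdistC y x) /=.
  split=> //; split=> //; split; first exact: ltW.
    by rewrite heron_sym Exyz; ring.
  by rewrite heron_sym.
(* Each pair of vertices isolates one of its members. No vertex belongs to all three pairs, so at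
   least two vertices are isolated. *)
have [[Ia Ib]|[[Ib Ic]|[Ic Ia]]] :
  (isolated lam a b c /\ isolated lam b c a) \/
  (isolated lam b c a /\ isolated lam c a b) \/
  (isolated lam c a b /\ isolated lam a b c).
- case: sab => [?|/isolatedC ?]; case: sbc => [?|/isolatedC ?];
    case: sca => [?|/isolatedC ?]; tauto.
- by apply: key => //; rewrite heron_area; [have := Ha Ia|have := Hb Ib]; lra.
- rewrite -(set3_rot a b c); apply: key => //; rewrite heron_rot.
  + by rewrite E; ring.
  + by rewrite heron_area; have := Hb Ib; lra.
  + by rewrite heron_area; have := Hc Ic; lra.
- rewrite -(set3_rot a b c) -(set3_rot b c a); apply: key => //; rewrite -heron_rot.
  + by rewrite E; ring.
  + by rewrite heron_area; have := Hc Ic; lra.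
  + by rewrite heron_area; have := Ha Ia; lra.
Qed.

Lemma circumcenter a b c : area a b c != 0 ->
  exists o, sqdist b o = sqdist a o /\ sqdist c o = sqdist a o.
Proof.
move=> D0; set D := area a b c in D0.
pose U := sqdist b a; pose V := sqdist c a.
exists (a + (2 * D)^-1 *: vec2 (U * (c 0 1 - a 0 1) - V * (b 0 1 - a 0 1))
                               (V * (b 0 0 - a 0 0) - U * (c 0 0 - a 0 0))).
by rewrite /U /V !sqdistE !coordE; split; rewrite /D /area in D0 *; field.
Qed.

(** * The isosceles triangle and the lattice generated by its legs *)

Section Isosceles.
(** [L] and [B] are the squared leg and base, for which [heron] equals [B (4 L - B)]. Thus [gE]
    makes [g] the circumradius, and [altitude] bounds the leg altitudes below by [2 lam]. *)
Variables (lam g L B : R).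
Hypothesis lam0 : 0 <= lam.
Hypothesis g0 : 0 < g.
Hypothesis g2 : g ^+ 2 < 2.
Hypothesis L4 : 4 <= L.
Hypothesis B4 : 4 <= B.
Hypothesis B2L : B <= 2 * L.
Hypothesis gE : g ^+ 2 * (4 * L - B) = L ^+ 2.
Hypothesis altitude : 16 * lam ^+ 2 * L <= B * (4 * L - B).

Lemma isosceles_circumcenter a b c :
  sqdist a b = B -> sqdist b c = L -> sqdist c a = L ->
  area a b c != 0 /\ exists o,
    [/\ sqdist a o = g ^+ 2, sqdist b o = g ^+ 2 & sqdist c o = g ^+ 2].
Proof.
move=> ab bc ca.
have BL : 0 < B * (4 * L - B) by apply: mulr_gt0; move: B4 B2L; lra.
have K : 4 * area a b c ^+ 2 = B * (4 * L - B).
  by rewrite -heron_area ab bc ca /heron; ring.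
have D0 : area a b c != 0.
  by apply: contraTneq BL => D0; rewrite -K D0 expr0n mulr0 ltxx.
split=> //; have [ o [bo co]] := circumcenter D0.
exists o; suff ao : sqdist a o = g ^+ 2 by rewrite bo co.
have := area_sqdist erefl bo co; rewrite ab bc ca => E.
apply: (mulIf (lt0r_neq0 BL)).
rewrite [RHS](_ : _ = B * (g ^+ 2 * (4 * L - B))); last by ring.
by rewrite gE -K; lra.
Qed.

Lemma int_sqr_ge1 (n : int) : n != 0 -> (1 : R) <= n%:~R ^+ 2.
Proof.
move=> n0; rewrite -rmorphXn /= ler1z -gtz0_ge1.
by rewrite lt_def sqrf_eq0 n0 sqr_ge0.
Qed.

(** The lines where [dotp u] is an integer carry [X] and are at least [2 lam] apart, so the lines
    halfway between them cut no open disk. *)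
Lemma integral_separation (X : set 'rV[R]_2) u p q : u <> 0 ->
  lam ^+ 2 * dotp u u <= 4^-1 ->
  (forall z, X z -> exists n : int, dotp u z = n%:~R) ->
  X p -> X q -> dotp u p < dotp u q ->
  exists (u : 'rV[R]_2) (k : R), [/\ u <> 0, disk p lam `<=` halfplane u k,
    disk q lam `<=` cohalfplane u k &
    forall z, X z -> line u k `&` interior (disk z lam) = set0].
Proof.
move=> u0 ulam uX Xp Xq pq; have uu := dotp_gt0 u0.
have [i pi] := uX p Xp; have [j qj] := uX q Xq.
have near z w : sqdist w z <= lam ^+ 2 -> - (1 / 2) <= dotp u (w - z) <= 1 / 2.
  move=> wz; apply: sqr_le_itv; first by lra.
  apply: le_trans (cauchy_schwarz _ _) _; apply: (@le_trans _ _ 4^-1); last by lra.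
  by apply: le_trans ulam; rewrite mulrC ler_pM2r.
have dB z w : dotp u (w - z) = dotp u w - dotp u z by rewrite !coordE; ring.
exists u, (i%:~R + 1 / 2); split=> //.
- move=> w; rewrite /disk /= edist_le // => /near; rewrite dB pi /halfplane /=.
  by move=> /andP[]; lra.
- move=> w; rewrite /disk /= edist_le // => /near; rewrite dB qj /cohalfplane /=.
  rewrite pi qj ltr_int in pq.
  have : (i + 1)%:~R <= j%:~R :> R by rewrite ler_int lezD1.
  by rewrite rmorphD /= => ? /andP[]; lra.
- move=> z Xz; apply/seteqP; split=> // w []; rewrite interior_disk /line /=.
  move=> uw; rewrite edist_lt // => wz; have [n zn] := uX z Xz.
  have h1 : dotp u (w - z) ^+ 2 < 4^-1.
    apply: le_lt_trans (cauchy_schwarz _ _) _; apply: lt_le_trans ulam.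
    by rewrite mulrC ltr_pM2r.
  rewrite dB uw zn in h1.
  have [ni|ni] := leP n i.
    by have : n%:~R <= i%:~R :> R; [rewrite ler_int|nra].
  have : (i + 1)%:~R <= n%:~R :> R by rewrite ler_int lezD1.
  by rewrite rmorphD /=; nra.
Qed.

Section Lattice.
Variables x y : R.
Hypothesis x0 : 0 < x.
Hypothesis y0 : 0 < y.
Hypothesis xx : x ^+ 2 = B / 4.
Hypothesis yy : y ^+ 2 = L - B / 4.

(** The generators are the legs; [x] is half the base and [y] the height on it. *)
Definition isosceles_point (i j : int) : 'rV[R]_2 :=
  vec2 x y *~ i + vec2 (- x) y *~ j.
Local Notation pt := isosceles_point.

Definition isosceles_lattice : set 'rV[R]_2 :=
  [set vec2 x y *~ ij.1 + vec2 (- x) y *~ ij.2 | ij in [set: int * int]].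

Lemma isosceles_pointE i j :
  pt i j = vec2 (x * (i%:~R - j%:~R)) (y * (i%:~R + j%:~R)).
Proof.
rewrite /pt -[vec2 x y *~ i]scaler_int -[vec2 (- x) y *~ j]scaler_int.
by apply: rV2P; rewrite !coordE; ring.
Qed.

Lemma isosceles_lattice_lattice : lattice isosceles_lattice.
Proof.
have bv0 : vec2 (- x) y != 0 :> 'rV[R]_2.
  apply/eqP => /(congr1 (fun u : 'rV[R]_2 => u 0 1)).
  by rewrite vec2_1 mxE; apply/eqP; rewrite gt_eqF.
have av_bv k : vec2 x y = k *: vec2 (- x) y :> 'rV[R]_2 -> False.
  move=> e.
  have e0 : vec2 x y 0 0 = (k *: vec2 (- x) y) 0 0 by rewrite -e.
  have e1 : vec2 x y 0 1 = (k *: vec2 (- x) y) 0 1 by rewrite -e.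
  rewrite vec2_0 mxE vec2_0 in e0; rewrite vec2_1 mxE vec2_1 in e1.
  by have := x0; have := y0; nra.
exists (vec2 x y), (vec2 (- x) y); split=> //.
rewrite free_cons span_seq1 seq1_free bv0 andbT.
by apply/negP => /vlineP[k /av_bv].
Qed.

(** The squared distance is [B/4 (I - J)^2 + (L - B/4) (I + J)^2]. It is at least [L] if neither
    bracket vanishes, at least [B] if [I + J = 0], and at least [4 L - B >= 2 L] if [I = J]. *)
Lemma isosceles_lattice_sqdist p q : isosceles_lattice p -> isosceles_lattice q ->
  p <> q -> 4 <= sqdist p q.
Proof.
move: L4 B4 B2L => L4' B4' B2L' [[i j] _ <-] [[i' j'] _ <-] /=.
rewrite -/(pt i j) -/(pt i' j') !isosceles_pointE => pq.
pose I := i - i'; pose J := j - j'.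
have -> : sqdist (vec2 (x * (i%:~R - j%:~R)) (y * (i%:~R + j%:~R)))
    (vec2 (x * (i'%:~R - j'%:~R)) (y * (i'%:~R + j'%:~R))) =
    B / 4 * (I - J)%:~R ^+ 2 + (L - B / 4) * (I + J)%:~R ^+ 2.
  by rewrite sqdistE !coordE -yy -xx /I /J !rmorphD /= !rmorphN /=; ring.
have b0 : 0 <= B / 4 by lra.
have l0 : 0 <= L - B / 4 by lra.
have [IJ|/int_sqr_ge1 IJ] := eqVneq (I + J) 0.
  have I0 : I != 0.
    apply/eqP => I0; apply: pq.
    have J0 : J = 0 by move: IJ; rewrite I0 add0r.
    by rewrite (subr0_eq I0) (subr0_eq J0).
  have -> : I - J = I *+ 2.
    by move/eqP: IJ; rewrite addrC addr_eq0 => /eqP ->; rewrite opprK mulr2n.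
  rewrite IJ mulr0z expr0n mulr0 addr0 rmorphMn /= exprMn_n.
  have := int_sqr_ge1 I0; nra.
have [JI|/int_sqr_ge1 JI] := eqVneq (I - J) 0; last by nra.
have I0 : I != 0.
  apply/eqP => I0; move: IJ; rewrite (subr0_eq JI) in I0 *.
  by rewrite I0 /= expr0n /= ler10.
rewrite JI mulr0z expr0n mulr0 add0r.
rewrite -(subr0_eq JI) rmorphD /=.
have := int_sqr_ge1 I0; nra.
Qed.

(** The dual basis. Integer level lines are parallel to a leg and spaced by the leg altitude, so the
    hypothesis [altitude] is the norm bound that [integral_separation] asks for. *)
Local Notation ua := (vec2 ((2 * x)^-1) ((2 * y)^-1)).
Local Notation ub := (vec2 (- (2 * x)^-1) ((2 * y)^-1)).

Let xn0 : x != 0. Proof. by rewrite gt_eqF. Qed.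
Let yn0 : y != 0. Proof. by rewrite gt_eqF. Qed.

Let uaE i j : dotp ua (pt i j) = i%:~R.
Proof. by rewrite isosceles_pointE !coordE; field; rewrite xn0 yn0. Qed.

Let ubE i j : dotp ub (pt i j) = j%:~R.
Proof. by rewrite isosceles_pointE !coordE; field; rewrite xn0 yn0. Qed.

Let dual_norm u : dotp u u = (2 * x)^-1 ^+ 2 + (2 * y)^-1 ^+ 2 ->
  u <> 0 /\ lam ^+ 2 * dotp u u <= 4^-1.
Proof.
move: L4 B4 B2L altitude => L4' B4' B2L' alt.
have x2 : 0 < x ^+ 2 by rewrite exprn_gt0.
have y2 : 0 < y ^+ 2 by rewrite exprn_gt0.
have -> : (2 * x)^-1 ^+ 2 + (2 * y)^-1 ^+ 2 = L / (4 * (x ^+ 2 * y ^+ 2)).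
  have -> : L = x ^+ 2 + y ^+ 2 by rewrite xx yy; ring.
  by field; rewrite xn0 yn0.
move=> uE; split.
  move=> u0; have : 0 < dotp u u by rewrite uE divr_gt0 ?mulr_gt0 //; lra.
  by rewrite u0 !coordE mul0r addr0 ltxx.
rewrite uE mulrA ler_pdivrMr ?mulr_gt0 // xx yy.
by lra.
Qed.

(** Distinct lattice points differ in an integer coordinate; [ua], [ub] or an opposite vector
    separates them in the right order. *)
Lemma isosceles_lattice_separable : totally_separable lam isosceles_lattice.
Proof.
have [ua0 uan] : ua <> 0 /\ lam ^+ 2 * dotp ua ua <= 4^-1.
  by apply: dual_norm; rewrite !coordE.
have [ub0 ubn] : ub <> 0 /\ lam ^+ 2 * dotp ub ub <= 4^-1.
  by apply: dual_norm; rewrite !coordE mulrNN.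
have opp (u : 'rV[R]_2) : u <> 0 -> lam ^+ 2 * dotp u u <= 4^-1 ->
    - u <> 0 /\ lam ^+ 2 * dotp (- u) (- u) <= 4^-1.
  move=> u0 un; split; first by move=> /eqP; rewrite oppr_eq0 => /eqP.
  by apply: le_trans un; rewrite !coordE !mulrNN.
have dN u z : dotp (- u) z = - dotp u z by rewrite !coordE; ring.
have uaX z : isosceles_lattice z -> exists n : int, dotp ua z = n%:~R.
  by move=> [[i j] _ <-]; exists i; rewrite -/(pt i j) uaE.
have ubX z : isosceles_lattice z -> exists n : int, dotp ub z = n%:~R.
  by move=> [[i j] _ <-]; exists j; rewrite -/(pt i j) ubE.
have oppX u : (forall z, isosceles_lattice z -> exists n : int, dotp u z = n%:~R) ->
    forall z, isosceles_lattice z -> exists n : int, dotp (- u) z = n%:~R.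
  by move=> uX z /uX[n zn]; exists (- n); rewrite dN zn rmorphN.
move=> p q Xp Xq pq.
have [lt|gt|eqa] := ltgtP (dotp ua p) (dotp ua q).
- exact: (integral_separation ua0 uan uaX Xp Xq).
- have [v0 vn] := opp ua ua0 uan.
  by apply: (integral_separation v0 vn (oppX _ uaX) Xp Xq); rewrite !dN ltrN2.
have [lt|gt|eqb] := ltgtP (dotp ub p) (dotp ub q).
- exact: (integral_separation ub0 ubn ubX Xp Xq).
- have [v0 vn] := opp ub ub0 ubn.
  by apply: (integral_separation v0 vn (oppX _ ubX) Xp Xq); rewrite !dN ltrN2.
exfalso; apply: pq; move: eqa eqb.
case: Xp => [[i j] _ <-]; case: Xq => [[i' j'] _ <-] /=.
by rewrite -/(pt i j) -/(pt i' j') !uaE !ubE => /intr_inj -> /intr_inj ->.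
Qed.

Lemma isosceles_lattice_covering : covering g isosceles_lattice.
Proof.
apply/coveringP => p.
pose i := Num.floor (dotp ua p); pose j := Num.floor (dotp ub p).
have [s0 s1] : 0 <= dotp ua p - i%:~R /\ dotp ua p - i%:~R <= 1.
  have /andP[h1 h2] := floor_itv (dotp ua p).
  by rewrite intrD in h2; rewrite /i; split; lra.
have [t0 t1] : 0 <= dotp ub p - j%:~R /\ dotp ub p - j%:~R <= 1.
  have /andP[h1 h2] := floor_itv (dotp ub p).
  by rewrite intrD in h2; rewrite /j; split; lra.
set s := _ - _ in s0 s1; set t := _ - _ in t0 t1.
have pE : p = vec2 (x * (i%:~R + s - (j%:~R + t))) (y * (i%:~R + s + (j%:~R + t))).
  apply: rV2P; rewrite ?vec2_0 ?vec2_1 /s /t !coordE; field; by rewrite xn0 yn0.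
have hull (c1 c2 c3 : 'rV[R]_2) : isosceles_lattice c1 -> isosceles_lattice c2 ->
    isosceles_lattice c3 -> sqdist c1 c2 = B -> sqdist c2 c3 = L -> sqdist c3 c1 = L ->
    barycentric c1 c2 c3 p -> exists2 z, isosceles_lattice z & edist p z <= g.
  move=> X1 X2 X3 d1 d2 d3 b.
  have [_ [ o [h1 h2 h3]]] := isosceles_circumcenter d1 d2 d3.
  have [|z Vz zp] := nearest_vertex h1 h2 h3 (q := p); first by rewrite convex_hull3E.
  exists z; first by move: Vz => [[->|->]|->].
  by rewrite edistC edist_le // ltW.
have X (m n : int) : isosceles_lattice (pt m n) by exists (m, n).
have dB : (2 * x) ^+ 2 = B by rewrite exprMn xx; field.
have dL : x ^+ 2 + y ^+ 2 = L by rewrite xx yy; field.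
(* The base diagonal cuts the cell of [p] into two copies of the triangle. *)
have [st|st] := leP (s + t) 1.
- apply: (hull _ _ _ (X (i + 1) j) (X i (j + 1)) (X i j)).
  + by rewrite sqdistE !isosceles_pointE !coordE !intrD -dB; ring.
  + by rewrite sqdistE !isosceles_pointE !coordE !intrD -dL; ring.
  + by rewrite sqdistE !isosceles_pointE !coordE !intrD -dL; ring.
  + exists s, t, (1 - s - t); split; [lra|lra|lra|lra|].
    by rewrite pE; apply: rV2P; rewrite !isosceles_pointE !coordE !intrD; ring.
- apply: (hull _ _ _ (X (i + 1) j) (X i (j + 1)) (X (i + 1) (j + 1))).
  + by rewrite sqdistE !isosceles_pointE !coordE !intrD -dB; ring.
  + by rewrite sqdistE !isosceles_pointE !coordE !intrD -dL; ring.
  + by rewrite sqdistE !isosceles_pointE !coordE !intrD -dL; ring.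
  + exists (1 - t), (1 - s), (s + t - 1); split; [lra|lra|lra|lra|].
    by rewrite pE; apply: rV2P; rewrite !isosceles_pointE !coordE !intrD; ring.
Qed.

End Lattice.

(** The only input specific to a range of [lam]: a lower bound for empty circles together with its
    case of equality. *)
Hypothesis extremal : forall (X : set 'rV[R]_2) o s a b c,
  (forall x y, X x -> X y -> x <> y -> 4 <= sqdist x y) ->
  totally_separable lam X -> delaunay_circle X o s a b c -> s <= g ^+ 2 ->
  s = g ^+ 2 /\ exists a' b' c', [/\ [set a; b; c] = [set a'; b'; c'],
    sqdist a' b' = B, sqdist b' c' = L & sqdist c' a' = L].

Let K : set (set 'rV[R]_2) :=
  triangle_with_edges (Num.sqrt B) (Num.sqrt L) (Num.sqrt L).

Lemma extremal_covering (X : set 'rV[R]_2) r :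
  separable_packing 1 lam X -> 0 < r -> covering r X -> g <= r.
Proof.
move=> [/packing_sqdist X4 sX] r0 cX; rewrite leNgt; apply/negP => rg.
(* Any point of the plane would do in place of the origin. *)
have [ o [s [sr hole ext]]] := extremal_circle 0 X4 cX.
have [ |a [b [c [[[Xa ha] [Xb hb] [Xc hc]] abc]]]] :=
    @extremal_three R [set x | X x /\ sqdist x o = s] 0.
  by move=> v /ext[[z [? ? ?]] [z' [? ? ?]]]; split; [exists z|exists z'].
have rg2 : r ^+ 2 < g ^+ 2 by rewrite ltr_sqr ?nnegrE ?ltW.
have dc : delaunay_circle X o s a b c by [].
have [sE _] := extremal X4 sX dc (ltW (le_lt_trans sr rg2)).
by move: (le_lt_trans sr rg2); rewrite sE ltxx.
Qed.

Lemma extremal_lattice : exists L', [/\ lattice L',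
  separable_packing 1 lam L' & covering g L'].
Proof.
have Bx : 0 < B by move: B4; lra.
have Ly : 0 < L - B / 4 by move: L4 B2L; lra.
have x0 : 0 < Num.sqrt B / 2 by rewrite divr_gt0 // sqrtr_gt0.
have y0 : 0 < Num.sqrt (L - B / 4) by rewrite sqrtr_gt0.
have xx : (Num.sqrt B / 2) ^+ 2 = B / 4.
  by rewrite exprMn exprVn sqr_sqrtr ?(ltW Bx) //; field.
have yy : Num.sqrt (L - B / 4) ^+ 2 = L - B / 4 by rewrite sqr_sqrtr // ltW.
exists (isosceles_lattice (Num.sqrt B / 2) (Num.sqrt (L - B / 4))); split.
- exact: isosceles_lattice_lattice.
- split; last exact: isosceles_lattice_separable.
  by apply/packing_sqdist; exact: isosceles_lattice_sqdist.
- exact: isosceles_lattice_covering.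
Qed.

Lemma extremal_tightness (F : set 'rV[R]_2) : separable_packing 1 lam F ->
  tightness F g <-> delaunay_triangles_tile_congruently F K.
Proof.
move=> sF; have [/packing_sqdist F4 tF] := sF.
have edge u v e : 0 <= e -> edist u v = Num.sqrt e <-> sqdist u v = e.
  move=> e0; split=> [h|h]; last by rewrite edistE h.
  by rewrite -sqr_edist h sqr_sqrtr.
have L0 : 0 <= L by move: L4; lra.
have B0 : 0 <= B by move: B4; lra.
split=> [[[_ cF] _]|tile].
- apply: (rigid_delaunay F4 g0 g2 cF).
    by move=> o s a b c dc sg; have [] := extremal F4 tF dc sg.
  move=> o a b c dc.
  have [_ [a' [b' [c' [-> ab bc ca]]]]] := extremal F4 tF dc (lexx _).
  have [D0 _] := isosceles_circumcenter ab bc ca.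
  split; last by exists a', b', c'; split=> //; apply/edge.
  split; last by exists a', b', c'.
  exists [set a'; b'; c']; split=> //; exact: interior_triangle.
- split; last by move=> r [r0 cF]; exact: extremal_covering cF.
  split=> //; apply: tile_covering tile => // T [_ [a [b [c [TE ab bc ca]]]]].
  have [_ [ o [ha hb hc]]] := isosceles_circumcenter
    ((edge _ _ _ B0).1 ab) ((edge _ _ _ L0).1 bc) ((edge _ _ _ L0).1 ca).
  by exists o, a, b, c.
Qed.

Lemma extremal_case : [/\ gamma lam g, gamma_lattice lam g &
  forall F : set 'rV[R]_2, separable_packing 1 lam F ->
    (tightness F g <-> delaunay_triangles_tile_congruently F K)].
Proof.
have [L' [lL sL cL]] := extremal_lattice; split.
- split; first by split=> //; exists L'.
  by move=> r [r0 [X [sX cX]]]; exact: extremal_covering cX.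
- split; first by split=> //; exists L'.
  by move=> r [r0 [X [_ sX cX]]]; exact: extremal_covering cX.
- exact: extremal_tightness.
Qed.

End Isosceles.
End Extremal.

(** * The three ranges of lam *)

Section Cases.
Variable R : realType.
Implicit Types (a b c o : 'rV[R]_2) (s lam d : R).

Lemma delaunay_circle_sides (X : set 'rV[R]_2) o s a b c :
  (forall x y, X x -> X y -> x <> y -> 4 <= sqdist x y) ->
  delaunay_circle X o s a b c ->
  [/\ 4 <= sqdist b c, 4 <= sqdist c a, 4 <= sqdist a b &
  [/\ 0 < heron (sqdist b c) (sqdist c a) (sqdist a b) &
    s * heron (sqdist b c) (sqdist c a) (sqdist a b) =
    sqdist b c * sqdist c a * sqdist a b]].
Proof.
move=> X4 [[Xa Xb Xc] [ab bc ca] [ha hb hc] _].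
split; [exact: X4|exact: X4|exact: X4|rewrite heron_area; split].
  by rewrite mulr_gt0 // lt_def sqr_ge0 sqrf_eq0 (area_neq0 ha hb hc).
by have := area_sqdist ha hb hc; lra.
Qed.

Lemma extremal_small (X : set 'rV[R]_2) o s a b c :
  (forall x y, X x -> X y -> x <> y -> 4 <= sqdist x y) ->
  delaunay_circle X o s a b c -> s <= 4 / 3 ->
  s = 4 / 3 /\ exists a' b' c', [/\ [set a; b; c] = [set a'; b'; c'],
    sqdist a' b' = 4, sqdist b' c' = 4 & sqdist c' a' = 4].
Proof.
move=> X4 dc s43; have [P4 Q4 W4 [K0 E]] := delaunay_circle_sides X4 dc.
have [sE PE QE WE] := regular_bound P4 Q4 W4 K0 E s43.
by split=> //; exists a, b, c.
Qed.

(** [d] stands for the square root of [1 - lam^2], and [2 / (1 + d)] is the rationalized form of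
    [(2 - 2 d) / lam^2]. *)
Lemma extremal_middle (X : set 'rV[R]_2) lam d o s a b c : 0 < lam ->
  lam ^+ 2 = 1 - d ^+ 2 -> 1 / 3 <= d -> d <= 1 / 2 ->
  (forall x y, X x -> X y -> x <> y -> 4 <= sqdist x y) ->
  totally_separable lam X -> delaunay_circle X o s a b c -> s <= 2 / (1 + d) ->
  s = 2 / (1 + d) /\ exists a' b' c', [/\ [set a; b; c] = [set a'; b'; c'],
    sqdist a' b' = 8 - 8 * d, sqdist b' c' = 4 & sqdist c' a' = 4].
Proof.
move=> lam0 lE d3 d2 X4 sX dc; have d0 : 0 < 1 + d by lra.
rewrite ler_pdivlMr // => sd.
have s2 : s < 2.
  have [s0|s0] := leP s 0; first by lra.
  by nra.
have [a' [b' [c' [-> [P4 Q4 W4 [QP E alt]]]]]] := separable_delaunay lam0 X4 sX dc s2.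
have [sE PE QE WE] := legs_bound_middle lam0 lE d3 d2 P4 Q4 W4 QP E s2 alt sd.
split; last by exists a', b', c'.
by rewrite -sE mulfK ?gt_eqF.
Qed.

Lemma extremal_large (X : set 'rV[R]_2) lam o s a b c : 0 < lam -> lam <= 1 ->
  (forall x y, X x -> X y -> x <> y -> 4 <= sqdist x y) ->
  totally_separable lam X -> delaunay_circle X o s a b c ->
  s <= 27 / 16 * lam ^+ 2 ->
  s = 27 / 16 * lam ^+ 2 /\ exists a' b' c', [/\ [set a; b; c] = [set a'; b'; c'],
    sqdist a' b' = 6 * lam ^+ 2, sqdist b' c' = 9 / 2 * lam ^+ 2 &
    sqdist c' a' = 9 / 2 * lam ^+ 2].
Proof.
move=> lam0 lam1 X4 sX dc sl.
have s2 : s < 2 by nra.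
have [a' [b' [c' [-> [P4 Q4 W4 [QP E alt]]]]]] := separable_delaunay lam0 X4 sX dc s2.
have [sE PE QE WE] := legs_bound_large lam0 P4 Q4 W4 QP E s2 alt sl.
by split=> //; exists a', b', c'.
Qed.

Lemma double_sqrt (y e : R) : 0 <= y -> (2 * y) ^+ 2 = e -> 2 * y = Num.sqrt e.
Proof. by move=> y0 <-; rewrite sqrtr_sqr ger0_norm // mulr_ge0. Qed.

Lemma double_xe lam y h : 0 < h -> y ^+ 2 - lam ^+ 2 = h ^+ 2 ->
  2 * xe lam y = y ^+ 2 / h.
Proof.
by move=> h0 e; rewrite /xe e sqrtr_sqr gtr0_norm //; field; rewrite gt_eqF.
Qed.

(** For [y^2 = 2 - 2 d] the radicand [y^2 - lam^2] is the square of [1 - d], so the legs have length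
    2. *)
Lemma Te_middle lam d : lam ^+ 2 = 1 - d ^+ 2 -> d <= 1 / 2 ->
  Te lam (Num.sqrt (2 - 2 * d)) =
  triangle_with_edges (Num.sqrt (8 - 8 * d)) (Num.sqrt 4) (Num.sqrt 4).
Proof.
move=> lE d2; rewrite /Te.
have yy : Num.sqrt (2 - 2 * d) ^+ 2 = 2 - 2 * d by rewrite sqr_sqrtr; lra.
have -> : 2 * xe lam (Num.sqrt (2 - 2 * d)) = Num.sqrt 4.
  rewrite (@double_xe _ _ (1 - d)); [|lra|by rewrite yy lE; ring].
  rewrite yy (_ : 4 = 2 ^+ 2); last by ring.
  by rewrite sqrtr_sqr ger0_norm //; field; rewrite subr_eq0; apply/eqP; lra.
congr (triangle_with_edges _ _ _); apply: double_sqrt; first exact: sqrtr_ge0.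
by rewrite exprMn yy; ring.
Qed.

(** Here [y^2 - lam^2 = lam^2 / 2], so the leg is [(3/2 lam^2) / (r lam) = 3 r lam] with
    [r^2 = 1/2]. *)
Lemma Te_large lam : 0 < lam -> Te lam (Num.sqrt (3 / 2) * lam) =
  triangle_with_edges (Num.sqrt (6 * lam ^+ 2)) (Num.sqrt (9 / 2 * lam ^+ 2))
    (Num.sqrt (9 / 2 * lam ^+ 2)).
Proof.
move=> lam0; rewrite /Te.
have yy : (Num.sqrt (3 / 2) * lam) ^+ 2 = 3 / 2 * lam ^+ 2.
  by rewrite exprMn sqr_sqrtr //; lra.
pose r : R := Num.sqrt (1 / 2).
have r0 : 0 < r by rewrite sqrtr_gt0; lra.
have rr : r ^+ 2 = 1 / 2 by rewrite sqr_sqrtr //; lra.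
have -> : 2 * xe lam (Num.sqrt (3 / 2) * lam) = Num.sqrt (9 / 2 * lam ^+ 2).
  rewrite (@double_xe _ _ (r * lam)); last 2 first.
  - by rewrite mulr_gt0.
  - by rewrite yy exprMn rr; field.
  have -> : 9 / 2 * lam ^+ 2 = (3 * r * lam) ^+ 2 by rewrite !exprMn rr; field.
  rewrite sqrtr_sqr ger0_norm; last by rewrite !mulr_ge0 // ltW.
  have rl : r * lam != 0 by rewrite mulf_neq0 ?gt_eqF.
  apply: (mulIf rl); rewrite divfK // yy.
  rewrite [RHS](_ : _ = 3 * r ^+ 2 * lam ^+ 2); last by ring.
  by rewrite rr; field.
congr (triangle_with_edges _ _ _); apply: double_sqrt.
  by rewrite mulr_ge0 ?sqrtr_ge0 // ltW.
by rewrite exprMn yy; field.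
Qed.

End Cases.

Theorem theorem2 (R : realType) (lam : R) (lam_ge0 : 0 <= lam) (lam_le1 : lam <= 1) :
  let g1 : R := 2 / Num.sqrt 3 in
  let g2 : R := Num.sqrt (2 - 2 * Num.sqrt (1 - lam ^+ 2)) / lam in
  let g3 : R := 3 * Num.sqrt 3 * lam / 4 in
  [/\ (lam <= Num.sqrt 3 / 2 ->
        [/\ gamma lam g1, gamma_lattice lam g1 &
            forall F : set 'rV[R]_2, separable_packing 1 lam F ->
              (tightness F g1 <->
               delaunay_triangles_tile_congruently F (@Te_reg R))]),
      (Num.sqrt 3 / 2 <= lam -> lam <= 2 * Num.sqrt 2 / 3 ->
        [/\ gamma lam g2, gamma_lattice lam g2 &
            forall F : set 'rV[R]_2, separable_packing 1 lam F ->
              (tightness F g2 <->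
               delaunay_triangles_tile_congruently F
                 (Te lam (Num.sqrt (2 - 2 * Num.sqrt (1 - lam ^+ 2)))))]) &
      (2 * Num.sqrt 2 / 3 <= lam ->
        [/\ gamma lam g3, gamma_lattice lam g3 &
            forall F : set 'rV[R]_2, separable_packing 1 lam F ->
              (tightness F g3 <->
               delaunay_triangles_tile_congruently F
                 (Te lam (Num.sqrt (3 / 2) * lam)))])].
Proof.
move=> g1 g2 g3.
have r3 : 0 < Num.sqrt 3 :> R by rewrite sqrtr_gt0.
have r2 : 0 < Num.sqrt 2 :> R by rewrite sqrtr_gt0.
have r33 : Num.sqrt 3 ^+ 2 = 3 :> R by rewrite sqr_sqrtr.
have r22 : Num.sqrt 2 ^+ 2 = 2 :> R by rewrite sqr_sqrtr.
have l2 : lam ^+ 2 <= 1 by rewrite expr_le1.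
split.
- move=> lam3.
  (* Exactly the condition that the altitude of the regular triangle of edge 2 is at least
     [2 lam]. *)
  have ll : lam ^+ 2 <= 3 / 4.
    have h : lam ^+ 2 <= (Num.sqrt 3 / 2) ^+ 2.
      by rewrite ler_sqr ?nnegrE // divr_ge0 // ltW.
    by move: h; rewrite exprMn r33; lra.
  have gg : g1 ^+ 2 = 4 / 3 by rewrite /g1 exprMn exprVn r33; field.
  have -> : @Te_reg R = triangle_with_edges (Num.sqrt 4) (Num.sqrt 4) (Num.sqrt 4).
    by rewrite (_ : 4 = 2 ^+ 2) ?sqrtr_sqr ?ger0_norm //; ring.
  apply: extremal_case => //; rewrite ?gg; try lra.
  + by rewrite divr_gt0.
  + by move=> X o s a b c X4 _ dc; exact: extremal_small X4 dc.
- move=> lam3 lam2.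
  have lam0 : 0 < lam by apply: lt_le_trans lam3; rewrite divr_gt0.
  pose d := Num.sqrt (1 - lam ^+ 2).
  have lE : lam ^+ 2 = 1 - d ^+ 2 by rewrite sqr_sqrtr; lra.
  have d0 : 0 <= d by exact: sqrtr_ge0.
  (* The lower end of the range makes the squared base [8 - 8 d] at least 4. *)
  have d12 : d <= 1 / 2.
    have h : (Num.sqrt 3 / 2) ^+ 2 <= lam ^+ 2.
      by rewrite ler_sqr ?nnegrE // divr_ge0 // ltW.
    by rewrite -ler_sqr ?nnegrE //; lra.
  have d13 : 1 / 3 <= d.
    have h : lam ^+ 2 <= (2 * Num.sqrt 2 / 3) ^+ 2.
      by rewrite ler_sqr ?nnegrE // divr_ge0 // mulr_ge0 // ltW.
    by rewrite -ler_sqr ?nnegrE //; lra.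
  have d1 : 1 + d != 0 by rewrite gt_eqF //; lra.
  have gg : g2 ^+ 2 = 2 / (1 + d).
    rewrite /g2 exprMn exprVn -/d sqr_sqrtr; last by lra.
    have ld : lam ^+ 2 = (1 - d) * (1 + d) by rewrite lE; ring.
    by rewrite ld; field; rewrite d1 subr_eq0; apply/eqP; lra.
  rewrite -/d (Te_middle lE d12).
  have gd : 2 / (1 + d) * (1 + d) = 2 by rewrite divfK.
  apply: extremal_case => //; rewrite ?gg.
  + by rewrite divr_gt0 // sqrtr_gt0 -/d; lra.
  + by rewrite ltr_pdivrMr; lra.
  + by lra.
  + by lra.
  + rewrite (_ : 4 * 4 - _ = 8 * (1 + d)); last by ring.
    by rewrite mulrCA gd; ring.
  + by rewrite lE; lra.
  + move=> X o s a b c X4 sX dc; exact: (extremal_middle lam0 lE d13 d12 X4 sX dc).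
- move=> lam2.
  have lam0 : 0 < lam by apply: lt_le_trans lam2; rewrite divr_gt0 // mulr_gt0.
  (* This makes the squared leg [9/2 lam^2] at least 4. *)
  have ll : 8 / 9 <= lam ^+ 2.
    have h : (2 * Num.sqrt 2 / 3) ^+ 2 <= lam ^+ 2.
      by rewrite ler_sqr ?nnegrE // divr_ge0 // mulr_ge0 // ltW.
    by move: h; rewrite !exprMn r22; lra.
  have gg : g3 ^+ 2 = 27 / 16 * lam ^+ 2.
    by rewrite /g3 !exprMn r33; field.
  rewrite (Te_large lam0); apply: extremal_case => //; rewrite ?gg.
  + by rewrite /g3 divr_gt0 // !mulr_gt0.
  + by lra.
  + by lra.
  + by lra.
  + by lra.
  + by field.
  + by rewrite -subr_ge0 (_ : _ - _ = 0) //; field.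
  + move=> X o s a b c X4 sX dc; exact: (extremal_large lam0 lam_le1 X4 sX dc).
Qed.
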